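(* Let $x$ be an $N$-periodic trajectory in a billiard with $C^2$ boundary, and suppose its second iterate $\hat x$ is nondegenerate with respect to periodic variations. If $i_\Delta(\hat x)$ is odd, then the multipliers of $x$ are complex conjugates on the unit circle, and consequently the periodic trajectory $x$ is linearly stable. If $i_\Delta(\hat x)$ is even, then the multipliers of $x$ are real reciprocals, and the periodic trajectory $x$ is linearly unstable.
   Context: Billiard setting. $\gamma:S^1\to\mathbb R^2$ is a positively oriented, unit-speed parametrized simple closed $C^2$ curve, the boundary of the billiard table. Put $\ell(u,v)=|\gamma(u)-\gamma(v)|$ and $S=-\ell$. For $N\ge 2$, $\mathcal C^N\subset(S^1)^{N+1}$ is the open set of admissible paths $x=(x^1,\dots,x^{N+1})$: for every $i=1,\dots,N$ one has $x^i\ne x^{i+1}$, and the line segment from $\gamma(x^i)$ to $\gamma(x^{i+1})$ is contained in the table and is never tangent to $\gamma$. Let $L(x)=\sum_{i=1}^N S(x^i,x^{i+1})$. An $N$-periodic trajectory is an $x\in\mathcal C^N$ with $x^1=x^{N+1}$, $\partial_1S(x^i,x^{i+1})+\partial_2S(x^{i-1},x^i)=0$ for $i=2,\dots,N$, and $\partial_1S(x^1,x^2)+\partial_2S(x^N,x^{N+1})=0$. Its second iterate is the $2N$-periodic trajectory $\hat x=(x^1,x^2,\dots,x^{N+1},x^2,\dots,x^{N+1})\in\mathcal C^{2N}$ ($x$ traversed twice). Index. For an $M$-periodic trajectory $z\in\mathcal C^M$, $H_z$ is the symmetric bilinear form on $\mathbb R^{M+1}$ with matrix $\big(\partial^2L/\partial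 z^i\partial z^j(z)\big)$; $i_\Delta(z)$ is the index (maximal dimension of a negative definite subspace) of the restriction of $H_z$ to the periodic variations $\{\delta z\in\mathbb R^{M+1}:\delta z^1=\delta z^{M+1}\}$, and $z$ is nondegenerate with respect to periodic variations if this restriction has trivial nullspace. Billiard map and stability. The billiard map $T:(x^i,y^i)\mapsto(x^{i+1},y^{i+1})$ on $S^1\times[-1,1]$, with $y^i=-\partial_1S(x^i,x^{i+1})=-\cos\phi^i$ ($\phi^i\in(0,\pi)$ the angle between $\dot\gamma(x^i)$ and the outgoing segment), sends a reflection point and angle to the next one; it is a local symplectomorphism near an admissible trajectory, with local generating function $S$. The multipliers of $x$ are the eigenvalues of the differential $dT^N$ at the corresponding periodic point $(x^1,y^1)$. The trajectory is linearly stable if every multiplier has modulus at most $1$, and linearly unstable otherwise. *)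

(* Defs.v *)
From HB Require Import structures.
From mathcomp Require Import all_boot all_order all_algebra.
From mathcomp Require Import all_classical all_reals all_analysis.
From mathcomp Require Import complex.

Set Implicit Arguments.
Unset Strict Implicit.
Unset Printing Implicit Defensive.

Import Order.TTheory GRing.Theory Num.Theory.
Import numFieldNormedType.Exports.

Local Open Scope classical_set_scope.
Local Open Scope ring_scope.

(* The norm carried by 'rV[R]_2 in the library is the sup norm, so the
   Euclidean structure of the plane is introduced here. *)
Section Plane.
Variable R : realType.
Implicit Types a b : 'rV[R]_2.

Definition vec2 (s t : R) : 'rV[R]_2 := \row_j (if j == 0 then s else t).

Definition dot a b : R := a 0 0 * b 0 0 + a 0 1 * b 0 1.

Definition enorm a : R := Num.sqrt (dot a a).

(* Rotation by +pi/2. *)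
Definition rot90 a : 'rV[R]_2 := vec2 (- a 0 1) (a 0 0).

Definition segment a b : set 'rV[R]_2 :=
  [set (1 - t) *: a + t *: b | t in `[0, 1]].

End Plane.

(* The circle is R / len Z; its points are represented by real numbers, and
   gamma by its len-periodic lift. *)
Section Curve.
Variables (R : realType) (len : R) (gamma : R -> 'rV[R]_2).

Definition same_point (s t : R) : Prop := exists k : int, s = t + k%:~R * len.

Definition C2_curve : Prop :=
  [/\ forall s, derivable gamma s 1,
      forall s, derivable (derive1 gamma) s 1 &
      continuous (derive1n 2 gamma)].

(* The union of the bounded components of the complement of the curve (by the
   Jordan curve theorem there is exactly one). *)
Definition enclosed : set 'rV[R]_2 :=
  [set a | ~ range gamma a /\
           bounded_set (connected_component (~` range gamma) a)].

Definition table : set 'rV[R]_2 := range gamma `|` enclosed.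

(* The table lies locally on the left of the curve and not on its right. *)
Definition positively_oriented : Prop := forall s,
  \forall e \near 0^'+,
    table (gamma s + e *: rot90 (derive1 gamma s)) /\
    ~ table (gamma s - e *: rot90 (derive1 gamma s)).

Definition billiard_boundary : Prop :=
  [/\ 0 < len,
      forall s t, gamma s = gamma t <-> same_point s t,
      C2_curve,
      forall s, enorm (derive1 gamma s) = 1 &
      positively_oriented].

(* The generating function S of the billiard map. *)
Definition gen (u v : R) : R := - enorm (gamma u - gamma v).

Definition d1gen (u v : R) : R := derive1 (fun s => gen s v) u.
Definition d2gen (u v : R) : R := derive1 (fun s => gen u s) v.

End Curve.

(* A path with N segments is a row vector of N.+1 parameters, indexed from 0;
   its entries are lifts of points of the circle. *)
Section Paths.
Variables (R : realType) (len : R) (gamma : R -> 'rV[R]_2).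

Definition vertex (N : nat) (x : 'rV[R]_N.+1) (i : nat) : R := x 0 (inord i).

Definition admissible_segment (u v : R) : Prop :=
  [/\ ~ same_point len u v,
      segment (gamma u) (gamma v) `<=` table gamma &
      forall s, segment (gamma u) (gamma v) (gamma s) ->
        forall c : R, gamma v - gamma u <> c *: derive1 gamma s].

Definition admissible_path (N : nat) (x : 'rV[R]_N.+1) : Prop :=
  forall i, (i < N)%N -> admissible_segment (vertex x i) (vertex x i.+1).

Definition path_action (N : nat) (x : 'rV[R]_N.+1) : R :=
  \sum_(i < N) gen gamma (vertex x i) (vertex x i.+1).

Definition periodic_trajectory (N : nat) (x : 'rV[R]_N.+1) : Prop :=
  [/\ admissible_path x,
      same_point len (vertex x 0) (vertex x N),
      forall i, (0 < i < N)%N ->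
        d1gen gamma (vertex x i) (vertex x i.+1)
        + d2gen gamma (vertex x i.-1) (vertex x i) = 0 &
      d1gen gamma (vertex x 0) (vertex x 1)
      + d2gen gamma (vertex x N.-1) (vertex x N) = 0].

Definition second_iterate (N : nat) (x : 'rV[R]_N.+1) : 'rV[R]_(2 * N).+1 :=
  \row_j vertex x (if (j <= N)%N then (j : nat) else (j - N)%N).

End Paths.

Section Index.
Variables (R : realType) (gamma : R -> 'rV[R]_2) (M : nat).
Implicit Types z v w : 'rV[R]_M.+1.

Definition hessian z : 'M[R]_M.+1 :=
  \matrix_(i, j)
    'D_(delta_mx 0 i) ('D_(delta_mx 0 j) (path_action gamma (N := M))) z.

Definition hess_form z v w : R := (v *m hessian z *m w^T) 0 0.

Definition periodic_variation v : Prop := v 0 ord0 = v 0 ord_max.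

Definition negative_definite_on z (U : {vspace 'rV[R]_M.+1}) : Prop :=
  forall v, v \in U -> v != 0 -> hess_form z v v < 0.

Definition periodic_index z : nat :=
  (\max_(k < M.+2 |
      `[< exists U : {vspace 'rV[R]_M.+1},
            [/\ \dim U = k,
                forall v, v \in U -> periodic_variation v &
                negative_definite_on z U] >]) k)%N.

Definition periodic_nondegenerate z : Prop :=
  forall v, periodic_variation v ->
    (forall w, periodic_variation w -> hess_form z v w = 0) -> v = 0.

End Index.

Section BilliardMap.
Variables (R : realType) (len : R) (gamma : R -> 'rV[R]_2).
Implicit Types p q : 'rV[R]_2.

(* A phase point p has coordinates p 0 0 = x and p 0 1 = y = - cos phi. The
   outgoing direction is cos phi * gamma' x + sin phi * rot90 (gamma' x). *)
Definition outgoing p : 'rV[R]_2 :=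
  (- p 0 1) *: derive1 gamma (p 0 0)
  + Num.sqrt (1 - p 0 1 ^+ 2) *: rot90 (derive1 gamma (p 0 0)).

(* The ray leaving gamma x in the outgoing direction meets the boundary for
   the first time at gamma x', where x' is lifted to ]x, x + len[; elastic
   reflection preserves the tangential component of the velocity, whence
   cos phi' = dot (outgoing p) (gamma' x'). *)
Definition billiard_step p q : Prop :=
  [/\ -1 < p 0 1 < 1,
      p 0 0 < q 0 0 < p 0 0 + len,
      exists t : R,
        [/\ 0 < t, gamma (q 0 0) = gamma (p 0 0) + t *: outgoing p &
            forall r, 0 < r < t ->
              ~ range gamma (gamma (p 0 0) + r *: outgoing p)] &
      q 0 1 = - dot (outgoing p) (derive1 gamma (q 0 0))].

(* The lift to R x [-1, 1] of the billiard map; points with no successor,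
   in particular those with y = -1 or y = 1, are left fixed. *)
Definition billiard_map p : 'rV[R]_2 := xget p [set q | billiard_step p q].

Definition initial_phase (N : nat) (x : 'rV[R]_N.+1) : 'rV[R]_2 :=
  vec2 (vertex x 0) (- d1gen gamma (vertex x 0) (vertex x 1)).

(* The translations of R / len Z have trivial differential, so the
   differential of the lifted N-th iterate is that of T^N at the periodic
   point. *)
Definition monodromy (N : nat) (x : 'rV[R]_N.+1) : 'M[R[i]]_2 :=
  map_mx (real_complex R) (jacobian (iter N billiard_map) (initial_phase x)).

Definition multiplier (N : nat) (x : 'rV[R]_N.+1) (mu : R[i]) : Prop :=
  eigenvalue (monodromy x) mu.

(* The multipliers, listed with algebraic multiplicity, form the list s. *)
Definition multipliers_are (N : nat) (x : 'rV[R]_N.+1) (s : seq R[i]) : Prop :=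
  char_poly (monodromy x) = \prod_(mu <- s) ('X - mu%:P).

Definition linearly_stable (N : nat) (x : 'rV[R]_N.+1) : Prop :=
  forall mu, multiplier x mu -> `|mu| <= 1.

Definition linearly_unstable (N : nat) (x : 'rV[R]_N.+1) : Prop :=
  ~ linearly_stable x.

End BilliardMap.

(* Main.v *)
(** On periodic variations the Hessian of the 2N-step action is a cyclic Jacobi
    matrix A whose off-diagonal entries are the mixed derivatives of S. Its
    kernel equation is solved by iterating the transfer matrices of S, which are
    the differentials of the billiard map, so det A equals, up to the square of
    a nonzero product, - det (M^2 - 1) = (tr M)^2 - 4, where M is the monodromy
    matrix, of determinant 1. As the parity of the index is the sign of det A,
    an odd index means |tr M| < 2 and an even index means |tr M| > 2.

    The billiard map is only specified as a first-hit map, so its differential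
    has to be found. A segment contained in the table and transversal to the
    curve meets it at its end points only, since beyond a crossing it would
    enter the complement. The first hit is then stable under perturbation by
    transversality and compactness of the curve, and differentiable by implicit
    differentiation. *)
Require Import Defs.
From mathcomp Require Import all_boot all_order all_algebra all_fingroup.
From mathcomp Require Import all_classical all_reals all_analysis.
From mathcomp Require Import complex.
From mathcomp Require Import ring lra zify.

Set Implicit Arguments.
Unset Strict Implicit.
Unset Printing Implicit Defensive.

Import Order.TTheory GRing.Theory Num.Theory.
Import numFieldNormedType.Exports.

Local Open Scope ring_scope.

(** * Quadratic forms and their negative index *)

(** The second iterate makes both ends of the elliptic range visible. For [x] itself the determinant
    would be, up to sign and a nonzero product, [det (M - 1) = 2 - tr M], which is blind to
    [tr M < -2]; doubling brings in the factor [2 + tr M]. It also makes the order of the matrix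
    even and the product of the off-diagonal entries a square, so that no sign depends on [N].
    Nondegeneracy excludes the two values [tr M = 2] and [tr M = -2]. On the geometric side, the
    orientation hypothesis speaks only of the normal direction at each point. It is carried over to
    every transversal direction by a truncated cone about the outer normal that avoids the curve.
    The differential of the first hit is then read off from continuous secant slopes at a single
    point, once the hit parameter is known to be continuous there. Matrices act on row vectors from
    the right, so products of transfer matrices are read in the order of the segments. *)

Section CongruenceDiagonalization.
Variable F : numFieldType.

Lemma unitmx_row0 n (v : 'rV[F]_n.+1) : v != 0 ->
  exists2 P : 'M[F]_n.+1, P \in unitmx & row 0 P = v.
Proof.
move=> v0.
have r1 : \rank v = 1%N.
  by apply/eqP; rewrite eqn_leq rank_leq_row lt0n mxrank_eq0.
pose c := col_ebase v 0 0.
have c0 : c != 0.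
  by have := col_ebase_unit v; rewrite unitmxE det_mx11 unitfE.
exists (c *: row_ebase v).
  rewrite unitmxE detZ unitrM unitrX ?unitfE //=.
  by have := row_ebase_unit v; rewrite unitmxE unitfE.
rewrite -[RHS](mulmx_ebase v) r1 linearZ /= -mulmxA.
rewrite [col_ebase v]mx11_scalar -/c mul_scalar_mx; congr (_ *: _).
rewrite rowE; congr (_ *m _).
by apply/matrixP=> i j; rewrite !mxE !ord1 /=; case: j => [[|j] hj].
Qed.

Definition bform n (A : 'M[F]_n) (v w : 'rV[F]_n) : F := (v *m A *m w^T) 0 0.

Lemma bformDl n (A : 'M[F]_n) u v w :
  bform A (u + v) w = bform A u w + bform A v w.
Proof. by rewrite /bform !mulmxDl mxE. Qed.

Lemma bformDr n (A : 'M[F]_n) u v w :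
  bform A u (v + w) = bform A u v + bform A u w.
Proof. by rewrite /bform linearD mulmxDr mxE. Qed.

Lemma bform_delta n (A : 'M[F]_n) i j :
  bform A (delta_mx 0 i) (delta_mx 0 j) = A i j.
Proof. by rewrite /bform -rowE trmx_delta -colE !mxE. Qed.

(** Lagrange's completion of squares: a vector on which the form does not vanish becomes the first
    basis vector, and induction applies to the Schur complement. *)
Lemma symmetric_diagonalizable n (A : 'M[F]_n) : A^T = A ->
  exists2 P : 'M[F]_n, P \in unitmx & exists d, P *m A *m P^T = diag_mx d.
Proof.
elim: n A => [|n IHn] A AT.
  exists 1%:M; first exact: unitmx1.
  by exists 0; apply/matrixP=> -[].
have [A0|] := eqVneq A 0.
  exists 1%:M; first exact: unitmx1.
  by exists 0; rewrite A0 mulmx0 mul0mx linear0.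
move=> Anz.
(* Polarization: if the form vanishes on all sums [e_i + e_j], the case [i = j] kills the diagonal
   of [A] and then the other cases kill the rest. *)
have [v vA] : exists v, bform A v v != 0.
  have [/existsP[p]|] := boolP [exists p : 'I_n.+1 * 'I_n.+1,
      bform A (delta_mx 0 p.1 + delta_mx 0 p.2)
              (delta_mx 0 p.1 + delta_mx 0 p.2) != 0].
    by move=> h; exists (delta_mx 0 p.1 + delta_mx 0 p.2).
  rewrite negb_exists => /forallP h.
  have {}h i j : A i i + A i j + (A i j + A j j) = 0.
    have := h (i, j); rewrite negbK bformDl !bformDr !bform_delta /= => /eqP.
    by have -> : A j i = A i j by rewrite -{1}AT mxE.
  case/negP: Anz; apply/eqP/matrixP=> i j; rewrite mxE.
  have d k : A k k = 0.
    move/eqP: (h k k); rewrite -!mulr2n -mulrnA mulrn_eq0 /= => /eqP //.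
  move/eqP: (h i j); rewrite !d add0r addr0 -mulr2n mulrn_eq0 /= => /eqP //.
have v0 : v != 0.
  by apply: contra_neq vA => ->; rewrite /bform !mul0mx mxE.
have [P0 P0u P0v] := unitmx_row0 v0.
pose A1 : 'M[F]_(1 + n) := P0 *m A *m P0^T.
have A1T : A1^T = A1 by rewrite /A1 !trmx_mul trmxK AT mulmxA.
pose a := bform A v v.
have A1ul : ulsubmx A1 = a%:M.
  apply/matrixP=> i j; rewrite !ord1 [RHS]mxE eqxx mulr1n.
  rewrite [LHS]mxE [LHS]mxE.
  have -> : lshift n (0 : 'I_1) = 0 :> 'I_(1 + n) by apply/val_inj.
  by rewrite -bform_delta /a -P0v /bform !rowE trmx_mul !mulmxA.
pose b := ursubmx A1; pose C := drsubmx A1.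
have A1dl : dlsubmx A1 = b^T by rewrite /b trmx_ursub A1T.
have CT : C^T = C by rewrite /C trmx_drsub A1T.
have A1E : A1 = block_mx a%:M b b^T C.
  by rewrite -[LHS]submxK A1ul A1dl.
have [Q Qu [d Qd]] : exists2 Q : 'M[F]_n, Q \in unitmx &
    exists d, Q *m (C - a^-1 *: (b^T *m b)) *m Q^T = diag_mx d.
  by apply: IHn; rewrite linearB linearZ /= trmx_mul trmxK CT.
(* Elimination of the first column followed by [Q] on the complement. *)
pose P1 : 'M[F]_(1 + n) := block_mx 1%:M 0 (- a^-1 *: (Q *m b^T)) Q.
exists (P1 *m P0 : 'M[F]_(1 + n)).
  have dP1 : \det P1 = \det Q by rewrite det_lblock det1 mul1r.
  by rewrite unitmx_mul P0u andbT unitmxE dP1 -unitmxE.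
exists (row_mx (a%:M : 'rV_1) d).
rewrite [RHS](diag_mx_row (a%:M : 'rV_1) d); rewrite trmx_mul.
have -> : P1 *m P0 *m A *m (P0^T *m P1^T) = P1 *m A1 *m P1^T.
  by rewrite /A1 !mulmxA.
rewrite A1E /P1 tr_block_mx !mulmx_block !trmx1 !trmx0 linearZ /= trmx_mul trmxK.
rewrite !(mul0mx, mulmx0, mul1mx, mulmx1, addr0, add0r).
have aK : a^-1 * a = 1 by rewrite mulVf.
have e1 : - a^-1 *: (Q *m b^T) *m a%:M + Q *m b^T = 0.
  by rewrite mul_mx_scalar scalerA mulrN divff // scaleN1r addrC subrr.
have e2 : a%:M *m (- a^-1 *: (b *m Q^T)) + b *m Q^T = 0.
  by rewrite mul_scalar_mx scalerA mulrN divff // scaleN1r addrC subrr.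
have e3 : (- a^-1 *: (Q *m b^T) *m b + Q *m C) *m Q^T = diag_mx d.
  rewrite -Qd; congr (_ *m _).
  by rewrite mulmxBr -scalemxAr -scalemxAl scaleNr mulmxA addrC.
have e4 : diag_mx (a%:M : 'rV_1) = a%:M.
  by apply/matrixP=> i j; rewrite !mxE !ord1.
by rewrite e1 e2 e3 e4 mul0mx add0r.
Qed.
End CongruenceDiagonalization.

Section RowSpan.
Variables (F : fieldType) (m n : nat) (B : 'M[F]_(m, n)).
Hypothesis Bfree : row_free B.
Implicit Types (p : {set 'I_m}) (c : 'rV[F]_m).

Definition row_span p : {vspace 'rV[F]_n} :=
  <<[tuple row (enum_val i) B | i < #|p|]>>%VS.

Lemma row_spanP p (v : 'rV_n) :
  reflect (exists2 c, v = c *m B & forall i, i \notin p -> c 0 i = 0)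
          (v \in row_span p).
Proof.
apply: (iffP idP) => [|[c -> c0]]; last first.
  rewrite mulmx_sum_row; apply: memv_suml => i _.
  have [ip|/c0 ->] := boolP (i \in p); last by rewrite scale0r mem0v.
  apply/memvZ/memv_span/tnthP; exists (enum_rank_in ip i).
  by rewrite tnth_mktuple enum_rankK_in.
move/coord_span=> ->; set k := coord _.
exists (\sum_i k i v *: delta_mx 0 (enum_val i)).
  rewrite mulmx_suml; apply: eq_bigr => i _.
  by rewrite -scalemxAl -rowE (nth_map i) ?size_enum_ord // nth_ord_enum.
move=> j jp; rewrite summxE big1 // => i _; rewrite !mxE.
case: (j =P enum_val i) => [ji|]; last by rewrite ?andbF mulr0.
by rewrite ji enum_valP in jp.
Qed.

Lemma dim_row_span p : \dim (row_span p) = #|p|.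
Proof.
rewrite /row_span; set X := [tuple _ | _ < _].
suff /eqP -> : free X by rewrite size_tuple.
apply/freeP => k kX j.
have : (\sum_i k i *: delta_mx 0 (enum_val i)) *m B = (0 : 'rV_m) *m B.
  rewrite mul0mx -[RHS]kX; rewrite mulmx_suml; apply: eq_bigr => i _.
  by rewrite -scalemxAl -rowE -tnth_nth tnth_mktuple.
move/(row_free_inj Bfree)/rowP/(_ (enum_val j)).
rewrite summxE (bigD1 j) //= big1 => [|i ij]; last first.
  rewrite !mxE; case: (enum_val j =P enum_val i) => [/enum_val_inj ji|];
    last by rewrite ?andbF mulr0.
  by rewrite ji eqxx in ij.
by rewrite !mxE !eqxx mulr1 addr0.
Qed.

End RowSpan.

Section NegativeIndex.
Variable F : realFieldType.

Lemma odd_card_lt0 (I : finType) (d : I -> F) : \prod_i d i != 0 ->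
  odd #|[set i | d i < 0]| = (\prod_i d i < 0).
Proof.
move=> d0; rewrite -sgr_lt0 (big_morph _ (@sgrM _) (@sgr1 _)).
have -> : \prod_i Num.sg (d i) = (-1) ^+ #|[set i | d i < 0]|.
  rewrite (bigID (mem [set i | d i < 0])) /= [X in _ * X]big1 ?mulr1 => [|i].
    rewrite (eq_bigr (fun=> -1)) ?prodr_const // => i.
    by rewrite inE => /ltr0_sg.
  rewrite inE -leNgt le_eqVlt => /orP[/eqP di|/gtr0_sg //].
  by case/negP: d0; rewrite (bigD1 i) //= -di mul0r.
by rewrite -signr_odd; case: odd; rewrite ?oppr_lt0 ?ltr01 // ltNge ler01.
Qed.

(** Sylvester's law of inertia. After diagonalization, a negative definite subspace meets the span
    of the basis vectors of nonnegative weight only in 0, so its dimension is at most the number of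
    negative weights. The change of basis multiplies the determinant by a square, hence its sign is
    the parity of that number. *)
Lemma index_parity m n (H : 'M[F]_n) (E : 'M[F]_(m, n)) :
  H^T = H -> row_free E -> \det (E *m H *m E^T) != 0 ->
  exists k, [/\ (k <= m)%N,
    exists U : {vspace 'rV[F]_n}, [/\ \dim U = k,
      forall v, v \in U -> (v <= E)%MS &
      forall v, v \in U -> v != 0 -> bform H v v < 0],
    forall U : {vspace 'rV[F]_n}, (forall v, v \in U -> (v <= E)%MS) ->
      (forall v, v \in U -> v != 0 -> bform H v v < 0) -> (\dim U <= k)%N &
    odd k = (\det (E *m H *m E^T) < 0)].
Proof.
move=> HT Efree; set A := E *m H *m E^T => A0.
have AT : A^T = A by rewrite /A !trmx_mul trmxK HT mulmxA.
have [P Pu [d Pd]] := symmetric_diagonalizable AT.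
have P0 : \det P != 0 by rewrite -unitfE -unitmxE.
pose B := P *m E.
have Bfree : row_free B.
  by rewrite /row_free mxrankMfree // mxrank_unit.
have BE v : (v <= B)%MS = (v <= E)%MS.
  by rewrite (eqmxMfull E) // row_full_unit.
have dE : \prod_i d 0 i = (\det P) ^+ 2 * \det A.
  by rewrite -det_diag -Pd !det_mulmx det_tr; ring.
have qE c : bform H (c *m B) (c *m B) = \sum_i d 0 i * c 0 i ^+ 2.
  rewrite /bform trmx_mul.
  have -> : c *m B *m H *m (B^T *m c^T) = c *m diag_mx d *m c^T.
    by rewrite -Pd /A /B trmx_mul !mulmxA.
  rewrite mul_mx_diag mxE; apply: eq_bigr => i _; rewrite !mxE; ring.
pose p := [set i | d 0 i < 0]; exists #|p|; split.
- by rewrite -[leqRHS]card_ord max_card.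
- exists (row_span B p); split; first exact: dim_row_span.
    by move=> v /row_spanP[c -> _]; rewrite -BE submxMl.
  move=> v /row_spanP[c -> c0] cB; rewrite qE.
  have [i ci] : exists i, c 0 i != 0.
    apply/existsP; apply: contraNT cB; rewrite negb_exists => /forallP cz.
    have -> : c = 0 by apply/rowP=> i; rewrite mxE; have := cz i; rewrite negbK => /eqP.
    by rewrite mul0mx.
  have ip : i \in p by apply: contraNT ci => /c0 ->.
  rewrite (bigD1 i) //= ltr_wnDr //; last first.
    by rewrite nmulr_rlt0 ?exprn_even_gt0 //; rewrite inE in ip.
  apply: sumr_le0 => j _; have [|/c0 ->] := boolP (j \in p).
    by rewrite inE => dj; rewrite mulr_le0_ge0 ?sqr_ge0 // ltW.
  by rewrite expr0n mulr0.
- move=> U UE Uneg; pose W := row_span B (~: p).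
  have UW : (U :&: W = 0)%VS.
    apply/eqP; rewrite -subv0; apply/subvP => v; rewrite memv_cap memv0.
    case/andP=> vU /row_spanP[c vc c0]; apply: contraT => /(Uneg _ vU).
    rewrite ltNge vc qE sumr_ge0 // => i _.
    have [ip|] := boolP (i \in p); first
      by rewrite (c0 i) ?finset.in_setC ?negbK // expr0n mulr0.
    by rewrite inE -leNgt => di; rewrite mulr_ge0 ?sqr_ge0.
  have UWT : (U + W <= row_span B [set: 'I_m])%VS.
    apply/subvP => _ /memv_addP[u uU [w /row_spanP[c -> _]] ->].
    have /submxP[c' ->] : (u <= B)%MS by rewrite BE UE.
    by rewrite -mulmxDl; apply/row_spanP; exists (c' + c) => // i; rewrite inE.
  move/dimvS: UWT; rewrite dim_row_span // cardsT card_ord.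
  have := dimv_sum_cap U W; rewrite UW dimv0 addn0 => ->.
  rewrite dim_row_span // -[m in (_ <= m)%N]card_ord -(cardsC p) leq_add2r.
  exact.
- by rewrite odd_card_lt0 dE ?mulf_neq0 ?sqrf_eq0 // pmulr_rlt0 // exprn_even_gt0.
Qed.

End NegativeIndex.

(** * Cyclic Jacobi matrices and transfer matrices *)

Definition mx22 (F : Type) (x00 x01 x10 x11 : F) : 'M[F]_2 :=
  \matrix_(i, j) if i == 0 then if j == 0 then x00 else x01
                 else if j == 0 then x10 else x11.

Lemma ord2P (k : 'I_2) : k = 0 \/ k = 1.
Proof.
by case: k => [[|[|k]] hk]; [left|right|]; try apply/val_inj.
Qed.

Lemma mx22P (F : Type) (M N : 'M[F]_2) :
  M 0 0 = N 0 0 -> M 0 1 = N 0 1 -> M 1 0 = N 1 0 -> M 1 1 = N 1 1 -> M = N.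
Proof.
move=> e00 e01 e10 e11; apply/matrixP=> i j.
by case: (ord2P i) => ->; case: (ord2P j) => ->.
Qed.

Lemma det_mx2 (F : comNzRingType) (M : 'M[F]_2) :
  \det M = M 0 0 * M 1 1 - M 0 1 * M 1 0.
Proof.
rewrite (expand_det_row _ 0) !big_ord_recl big_ord0 addr0 /cofactor !det_mx11.
rewrite !mxE /= expr0 expr1 mul1r mulN1r mulrN.
by congr (_ * M _ _ - M _ _ * M _ _); apply/val_inj.
Qed.

Lemma mulmx2E (F : pzSemiRingType) m n (M : 'M[F]_(m, 2)) (N : 'M[F]_(2, n)) i j :
  (M *m N) i j = M i 0 * N 0 j + M i 1 * N 1 j.
Proof.
rewrite mxE !big_ord_recl big_ord0 addr0.
by congr (M _ _ * N _ _ + M _ _ * N _ _); apply/val_inj.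
Qed.

Lemma sum_indicator (F : pzSemiRingType) (I : finType) (i : I) (f : I -> F) :
  \sum_k (k == i)%:R * f k = f i.
Proof.
rewrite (bigD1 i) //= big1 => [|k /negPf ->]; last by rewrite mul0r.
by rewrite eqxx mul1r addr0.
Qed.

Section CyclicJacobi.
Variables (F : fieldType) (a b d : nat -> F).
Hypothesis b0 : forall k, b k != 0.

(** The second variation of a sum of functions of consecutive vertices: [a k], [b k], [d k] stand
    for the derivatives S11, S12, S22 of the [k]-th term. *)
Definition jacobi_form m (v w : nat -> F) : F :=
  \sum_(k < m) (a k * (v k * w k) + b k * (v k * w k.+1 + v k.+1 * w k)
                + d k * (v k.+1 * w k.+1)).

(** The linearized map sending the row [(u_k, eta_k)] to [(u_k+1, eta_k+1)], where [eta] is the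
    variation of the momentum: [eta_k = - (a_k u_k + b_k u_k+1)] and
    [eta_k+1 = b_k u_k + d_k u_k+1]. *)
Definition transfer k : 'M[F]_2 :=
  mx22 (- a k / b k) (b k - d k * a k / b k) (- (b k)^-1) (- d k / b k).

Fixpoint transfer_prod k : 'M[F]_2 :=
  if k is k'.+1 then transfer_prod k' *m transfer k' else 1%:M.

Lemma det_transfer_prod k : \det (transfer_prod k) = 1.
Proof.
elim: k => [|k IHk] /=; first exact: det1.
rewrite det_mulmx IHk mul1r det_mx2 !mxE /=; have := b0 k; move=> ?; field.
by [].
Qed.

(** Periodic extension of a unit vector: its value at [m] repeats the one at 0, so these sequences
    also describe the closed variations with [m.+1] entries. *)
Definition cyclic_unit m (i : 'I_m) (k : nat) : F := (k %% m == i)%N%:R.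

Definition cyclic_jacobi m : 'M[F]_m :=
  \matrix_(i, j) jacobi_form m (cyclic_unit i) (cyclic_unit j).

(** Only the two terms adjacent to the vertex [i] contribute. Nothing wraps around in [w]: for
    [i = 0] the second group reads [w] at [m - 1] and at [m]. *)
Lemma jacobi_form_cyclic_unit m (i : 'I_m) w :
  jacobi_form m (cyclic_unit i) w =
    (a i * w i + b i * w i.+1) +
    (b (ord_pred i) * w (ord_pred i) + d (ord_pred i) * w (ord_pred i).+1).
Proof.
rewrite /jacobi_form.
rewrite -(sum_indicator i (fun k => a k * w k + b k * w k.+1)).
rewrite -(sum_indicator (ord_pred i) (fun k => b k * w k + d k * w k.+1)).
rewrite -big_split; apply: eq_bigr => k _; rewrite /cyclic_unit.
rewrite modn_small ?ltn_ord //.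
have -> : (k.+1 %% m == i)%N = (k == ord_pred i).
  rewrite -(inj_eq (bij_inj (ordS_bij m))) ord_predK -val_eqE /=.
  by [].
have -> : (k == i :> nat) = (k == i) by [].
by rewrite /=; ring.
Qed.

Lemma cyclic_jacobi_mulE m n (W : 'M[F]_(m, n)) i j (w : nat -> F) :
    (forall k : 'I_m, w k = W k j) -> w m = w 0%N ->
  (cyclic_jacobi m *m W) i j = jacobi_form m (cyclic_unit i) w.
Proof.
move=> wW wm; rewrite mxE.
under eq_bigr do rewrite mxE -wW.
rewrite /jacobi_form; under eq_bigr do rewrite big_distrl /=.
rewrite exchange_big /=; apply: eq_bigr => k _.
have wE (l : nat) : (l <= m)%N -> w l = \sum_(x < m) cyclic_unit x l * w x.
  move=> lm.
  have m0 : (0 < m)%N by exact: leq_ltn_trans (leq0n k) (ltn_ord k).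
  have -> : w l = w (l %% m)%N.
    case: (ltngtP l m) lm => // [lm _|-> _]; first by rewrite modn_small.
    by rewrite modnn.
  rewrite -(sum_indicator (Ordinal (ltn_pmod l m0)) w).
  by apply: eq_bigr => x _; rewrite /cyclic_unit -val_eqE eq_sym.
rewrite [in RHS](wE k (ltnW (ltn_ord k))) [in RHS](wE k.+1 (ltn_ord k)).
rewrite !mulr_sumr -!big_split /= !mulr_sumr -!big_split /=; apply: eq_bigr => x _.
by ring.
Qed.

Definition solution (z : 'rV[F]_2) k : 'rV[F]_2 := z *m transfer_prod k.

(** Eliminating [eta k.+1] between the second equation at [k] and the first at [k.+1] gives row
    [k.+1] of the kernel equation of the Jacobi form. *)
Lemma solutionP z k (u := fun l => solution z l 0 0) (eta := fun l =>
  solution z l 0 1) :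
  a k * u k + b k * u k.+1 = - eta k /\ eta k.+1 = b k * u k + d k * u k.+1.
Proof.
have zS : solution z k.+1 = solution z k *m transfer k by rewrite /solution mulmxA.
have bk := b0 k.
rewrite /u /eta zS !mulmx2E !mxE /=; split; field => //.
Qed.

(* Multiply on the right by [W], whose first two columns are the solutions of the
   recurrence with (u_0, u_1) = (1, 0) and (0, 1) and whose others are unit
   vectors, then move the last row to the top: the result is block triangular. *)
Lemma det_cyclic_jacobi n :
  \det (cyclic_jacobi n.+2) =
    (-1) ^+ n.+1 * \prod_(k < n.+2) b k * \det (transfer_prod n.+2 - 1%:M).
Proof.
(* The rows are the initial data [(u_0, eta_0)], with [eta_0 = - (a_0 u_0 + b_0 u_1)], of the two
   solutions. *)
pose Z := mx22 1 (- a 0%N) 0 (- b 0%N).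
pose z (j : 'I_2) := row j Z.
pose u j k := solution (z j) k 0 0; pose eta j k := solution (z j) k 0 1.
have u0 j : u j 0%N = Z j 0 by rewrite /u /solution mulmx1 mxE.
have eta0 j : eta j 0%N = Z j 1 by rewrite /eta /solution mulmx1 mxE.
have u1 j : u j 1%N = (j == 1)%:R.
  have [e _] := solutionP (z j) 0%N; apply: (mulfI (b0 0%N));
    apply: (addrI (a 0%N * u j 0%N)).
  rewrite [LHS]e -/(eta j 0%N) eta0 u0.
  by case: (ord2P j) => ->; rewrite !mxE /=; ring.
pose W : 'M[F]_(2 + n) := \matrix_(i, j)
  match fintype.split j with inl j' => u j' i | inr _ => (i == j)%:R end.
have Wl i (j : 'I_2) : W i (lshift n j) = u j i.
  by rewrite mxE -[lshift n j]/(unsplit (inl j)) unsplitK.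
have Wr i (j : 'I_n) : W i (rshift 2 j) = (i == rshift 2 j)%:R.
  by rewrite mxE -[X in fintype.split X]/(unsplit (inr j)) unsplitK.
have detW : \det W = 1.
  have -> : W = block_mx 1%:M 0 (dlsubmx W) 1%:M.
    rewrite -[LHS]submxK; congr block_mx; apply/matrixP=> i j.
    - rewrite [LHS]mxE [LHS]mxE Wl mxE.
      case: (ord2P i) => ->; last by rewrite u1 eq_sym.
      by rewrite u0; case: (ord2P j) => ->; rewrite !mxE.
    - by rewrite [LHS]mxE [LHS]mxE Wr eq_lrshift mxE.
    - by rewrite [LHS]mxE [LHS]mxE Wr eq_rshift mxE.
  by rewrite det_lblock !det1 mulr1.
pose s : 'S_(n.+2) := lift_perm ord0 ord_max 1%g.
have s0 : s ord0 = ord_max by rewrite lift_perm_id.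
have sS (i : 'I_n.+2) k : i = k.+1 :> nat -> s i = k :> nat.
  case: (unliftP ord0 i) => [l ->|-> //]; rewrite lift_perm_lift perm1 lift0.
  by case=> <-; exact: lift_max.
pose B : 'M[F]_(2 + n) := row_perm s (cyclic_jacobi n.+2 *m W).
(* A column of the matrix closes up with [u j 0], whereas the solution goes on with [u j n.+2]; the
   difference is seen only by the two rows that wrap around. *)
pose w j k := if (k < n.+2)%N then u j k else u j 0%N.
have Bl i (j : 'I_2) : B i (lshift n j) =
    a (s i) * w j (s i) + b (s i) * w j (s i).+1 +
    (b (ord_pred (s i)) * w j (ord_pred (s i)) +
     d (ord_pred (s i)) * w j (ord_pred (s i)).+1).
  rewrite mxE -jacobi_form_cyclic_unit; apply: cyclic_jacobi_mulE.
    by move=> k; rewrite Wl /w ltn_ord.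
  by rewrite /w ltnn.
have Br i (j : 'I_n) (v := fun k => (k == j.+2)%:R) : B i (rshift 2 j) =
    a (s i) * v (s i) + b (s i) * v (s i).+1 +
    (b (ord_pred (s i)) * v (ord_pred (s i)) +
     d (ord_pred (s i)) * v (ord_pred (s i)).+1).
  rewrite mxE -jacobi_form_cyclic_unit; apply: cyclic_jacobi_mulE.
    by move=> k; rewrite Wr /v -val_eqE.
  by rewrite /v gtn_eqF // !ltnS.
have sv (i : 'I_n) : s (rshift 2 i) = i.+1 :> nat by exact: sS.
have pv (i : 'I_n) : ord_pred (s (rshift 2 i)) = i :> nat.
  rewrite /= sv addSn /= modnDr modn_small //.
  by have := ltn_ord i; lia.
(* These are the rows that do not wrap around, where the solutions satisfy the kernel equation. *)
have BE : B = block_mx (ulsubmx B) (ursubmx B) 0 (drsubmx B).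
  rewrite -[LHS]submxK; congr block_mx; apply/matrixP=> i j.
  rewrite [LHS]mxE [LHS]mxE Bl mxE pv sv.
  rewrite /w !ltnS ltn_ord (ltnW (ltn_ord i)) (leqW (ltnW (ltn_ord i))).
  have [e1 _] := solutionP (z j) i.+1; have [_ e2] := solutionP (z j) i.
  by rewrite [X in X + _]e1 -[X in _ + X]e2 addNr.
(* In the two remaining rows the failure to close up is linear in [D], the displacement of the phase
   vectors after one period. *)
have detK : \det (ulsubmx B) = b n.+1 * b 0%N * \det (transfer_prod n.+2 - 1%:M).
  pose D := Z *m (transfer_prod n.+2 - 1%:M).
  have uE j k l : (solution (z j) k) 0 l = (Z *m transfer_prod k) j l.
    by rewrite /solution /z -row_mul mxE.
  have D0 j : D j 0 = u j n.+2 - u j 0%N.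
    by rewrite u0 /u uE /D mulmxBr mulmx1 mxE [X in _ + X]mxE.
  have D1 j : D j 1 = eta j n.+2 - eta j 0%N.
    by rewrite eta0 /eta uE /D mulmxBr mulmx1 mxE [X in _ + X]mxE.
  have K0 j : ulsubmx B 0 j = - b n.+1 * D j 0.
    rewrite [LHS]mxE [LHS]mxE Bl D0.
    have -> : s (lshift n (0 : 'I_2)) = ord_max .
      by rewrite -s0; congr (s _); apply/val_inj.
    have -> : ord_pred (@ord_max n.+1) = n :> nat.
      by rewrite /= modnDr modn_small.
    rewrite /w /= ltnn !ltnS leqnSn leqnn.
    have [e1 _] := solutionP (z j) n.+1; have [_ e2] := solutionP (z j) n.
    rewrite [X in _ + X](esym e2) -/(eta j _).
    have -> : eta j n.+1 = - (a n.+1 * u j n.+1 + b n.+1 * u j n.+2).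
      by rewrite [X in - X]e1 opprK.
    by ring.
  have K1 j : ulsubmx B 1 j = D j 1 - d n.+1 * D j 0.
    rewrite [LHS]mxE [LHS]mxE Bl D0 D1.
    have s1 : s (lshift n (1 : 'I_2)) = 0%N :> nat by exact: sS.
    have -> : ord_pred (s (lshift n (1 : 'I_2))) = n.+1 :> nat.
      by rewrite /= s1 modn_small.
    rewrite s1 /w /= ltnn !ltnS leqnn.
    have [e1 _] := solutionP (z j) 0%N; have [_ e2] := solutionP (z j) n.+1.
    have -> : eta j 0%N = - (a 0%N * u j 0%N + b 0%N * u j 1%N).
      by rewrite [X in - X]e1 opprK.
    rewrite [eta j _]e2 -/(u j _) -/(u j _).
    by ring.
  have dD : \det D = - b 0%N * \det (transfer_prod n.+2 - 1%:M).
    by rewrite /D det_mulmx det_mx2 !mxE /=; ring.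
  rewrite -[b 0%N]opprK mulrN mulNr -mulrA -dD !det_mx2 !K0 !K1; ring.
have detL : \det (drsubmx B) = \prod_(k < n) b k.+1.
  rewrite det_trig.
    apply: eq_bigr => i _; rewrite [LHS]mxE [LHS]mxE Br pv sv eqxx.
    by rewrite !ltn_eqF //=; ring.
  apply/is_trig_mxP => i j ij.
  rewrite [LHS]mxE [LHS]mxE Br pv sv !ltn_eqF ?ltnS //=; first ring.
  - by rewrite ltnW // ltnS ltnW.
  - by rewrite ltnW // ltnW.
have : \det B = (-1) ^+ n.+1 * \det (cyclic_jacobi n.+2).
  rewrite /B row_permE !det_mulmx det_perm detW mulr1; congr (_ * _).
  by rewrite odd_lift_perm odd_perm1 addbF /= -[in RHS]signr_odd.
rewrite BE det_ublock detK detL => e.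
rewrite [in RHS]big_ord_recl [in RHS]big_ord_recr /=.
apply: (mulfI (_ : (-1) ^+ n.+1 != 0 :> F)); first by rewrite signr_eq0.
by rewrite -e !mulrA -expr2 sqrr_sign /bump /=; ring.
Qed.
End CyclicJacobi.

Lemma jacobi_form_eq (F : fieldType) n (a b d a' b' d' v w v' w' : nat -> F) :
  (forall k, (k < n)%N -> [/\ a k = a' k, b k = b' k & d k = d' k]) ->
  (forall k, (k <= n)%N -> v k = v' k /\ w k = w' k) ->
  jacobi_form a b d n v w = jacobi_form a' b' d' n v' w'.
Proof.
move=> h h'; apply: eq_bigr => k _.
have [-> -> ->] := h k (ltn_ord k).
have [-> ->] := h' k (ltnW (ltn_ord k)).
by have [-> ->] := h' k.+1 (ltn_ord k).
Qed.

Section Doubling.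
Variables (F : fieldType) (a b d : nat -> F) (N : nat).
Hypotheses (aN : forall k, a (k + N)%N = a k) (bN : forall k, b (k + N)%N = b k)
  (dN : forall k, d (k + N)%N = d k).

Lemma transfer_prod_double :
  transfer_prod a b d (2 * N) = transfer_prod a b d N *m transfer_prod a b d N.
Proof.
rewrite mul2n -addnn.
have H k : transfer_prod a b d (N + k) = transfer_prod a b d N *m transfer_prod a b d k.
  elim: k => [|k IHk]; first by rewrite addn0 mulmx1.
  by rewrite addnS /= IHk mulmxA /transfer (addnC N) aN bN dN.
exact: H.
Qed.

Lemma prod_double : \prod_(k < 2 * N) b k = (\prod_(k < N) b k) ^+ 2.
Proof.
rewrite mul2n -addnn big_split_ord /= expr2; congr (_ * _).
by apply: eq_bigr => k _; rewrite addnC bN.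
Qed.

End Doubling.

Lemma tr_mx2 (F : nzRingType) (M : 'M[F]_2) : \tr M = M 0 0 + M 1 1.
Proof.
rewrite /mxtrace !big_ord_recl big_ord0 addr0.
by congr (_ + M _ _); apply/val_inj.
Qed.

(** The factors [M - 1] and [M + 1] have determinants [2 - \tr M] and [2 + \tr M]. *)
Lemma det_sqr_sub1 (F : comNzRingType) (M : 'M[F]_2) : \det M = 1 ->
  \det (M *m M - 1%:M) = 4 - (\tr M) ^+ 2.
Proof.
move=> dM; have -> : M *m M - 1%:M = (M - 1%:M) *m (M + 1%:M).
  by rewrite mulmxBl mulmxDr !mulmx1 mul1mx opprD addrA addrK.
rewrite det_mulmx !det_mx2 tr_mx2 !mxE /=.
rewrite !(mulr1n, mulr0n) in dM *; rewrite det_mx2 in dM.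
have -> : (M 0 0 - 1) * (M 1 1 - 1) - (M 0 1 - 0) * (M 1 0 - 0) =
  (M 0 0 * M 1 1 - M 0 1 * M 1 0) - (M 0 0 + M 1 1) + 1 by ring.
have -> : (M 0 0 + 1) * (M 1 1 + 1) - (M 0 1 + 0) * (M 1 0 + 0) =
  (M 0 0 * M 1 1 - M 0 1 * M 1 0) + (M 0 0 + M 1 1) + 1 by ring.
by rewrite dM; ring.
Qed.

(** The order [2 * N] is even, so the sign factor is always -1, and the product of the [b k] over
    two rounds is a square: the sign is decided by the trace alone. *)
Lemma det_cyclic_jacobi_double (F : fieldType) (a b d : nat -> F) N :
    (0 < N)%N -> (forall k, b k != 0) ->
    (forall k, a (k + N)%N = a k) -> (forall k, b (k + N)%N = b k) ->
    (forall k, d (k + N)%N = d k) ->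
  \det (cyclic_jacobi a b d (2 * N)) =
    (\prod_(k < N) b k) ^+ 2 * ((\tr (transfer_prod a b d N)) ^+ 2 - 4).
Proof.
move=> N0 b0 aN bN dN.
have E : (2 * N = (2 * N).-2.+2)%N by lia.
have := det_cyclic_jacobi a d b0 (2 * N).-2; rewrite -E => ->.
rewrite prod_double // transfer_prod_double // det_sqr_sub1;
  last exact: det_transfer_prod.
rewrite -signr_odd (_ : odd _ = true); last by lia.
by rewrite /= expr1; ring.
Qed.

Lemma char_poly_mx2 (F : comNzRingType) (M : 'M[F]_2) :
  char_poly M = 'X^2 - (\tr M)%:P * 'X + (\det M)%:P.
Proof.
rewrite /char_poly /char_poly_mx [LHS]det_mx2 !mxE /= det_mx2 tr_mx2 !(mulr1n, mulr0n).
by rewrite !(rmorphB, rmorphD, rmorphM) /=; ring.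
Qed.

(** * Eigenvalues of a real 2 by 2 matrix of determinant one *)

Section UnimodularMultipliers.
Local Open Scope complex_scope.
Variables (R : rcfType) (M : 'M[R]_2).
Hypothesis detM : \det M = 1.

Let MC := map_mx (real_complex R) M.

Lemma char_poly_unimodular (x y : R[i]) :
  x * y = 1 -> x + y = (\tr M)%:C ->
  char_poly MC = \prod_(mu <- [:: x; y]) ('X - mu%:P).
Proof.
move=> xy1 xyt; rewrite char_poly_mx2 big_cons big_seq1.
have -> : \tr MC = x + y by rewrite xyt /MC trace_map_mx.
have -> : \det MC = x * y by rewrite xy1 /MC det_map_mx detM rmorph1.
by rewrite rmorphD rmorphM /=; ring.
Qed.

Lemma elliptic_multipliers : (\tr M) ^+ 2 < 4 ->
  exists mu : R[i], [/\ mu \isn't Num.real, `|mu| = 1 &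
    char_poly MC = \prod_(mu <- [:: mu; Num.conj mu]) ('X - mu%:P)].
Proof.
set t := \tr M => t4.
pose w := Num.sqrt (4 - t ^+ 2).
have w2 : w ^+ 2 = 4 - t ^+ 2 by rewrite sqr_sqrtr // subr_ge0 ltW.
have w0 : 0 < w by rewrite sqrtr_gt0 subr_gt0.
(* The root of [X^2 - t X + 1] with positive imaginary part. *)
pose mu : R[i] := Complex (t / 2) (w / 2).
have mu1 : mu * Num.conj mu = 1.
  rewrite /mu; apply/eqP; rewrite eq_complex /=.
  apply/andP; split; apply/eqP; last by ring.
  have -> : t / 2 * (t / 2) - w / 2 * - (w / 2) = (t ^+ 2 + w ^+ 2) / 4 by field.
  by rewrite w2; field.
exists mu; split.
- apply/negP => /complex_realP[r] /eqP; rewrite eq_complex /= => /andP[_ /eqP].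
  by move=> wz; move: w0; lra.
- by apply/eqP; rewrite -sqrp_eq1 ?normr_ge0 // normCK mu1.
- apply: char_poly_unimodular => //; rewrite /mu.
  by apply/eqP; rewrite eq_complex /=; apply/andP; split; apply/eqP; lra.
Qed.

Lemma hyperbolic_multipliers : 4 < (\tr M) ^+ 2 ->
  exists mu : R, [/\ mu != 0,
    char_poly MC = \prod_(mu <- [:: mu%:C; (mu^-1)%:C]) ('X - mu%:P) &
    `|mu| != 1].
Proof.
set t := \tr M => t4.
pose w := Num.sqrt (t ^+ 2 - 4).
have w2 : w ^+ 2 = t ^+ 2 - 4 by rewrite sqr_sqrtr // subr_ge0 ltW.
pose mu := (t + w) / 2; pose nu := (t - w) / 2.
have mn : mu * nu = 1.
  have -> : mu * nu = (t ^+ 2 - w ^+ 2) / 4 by rewrite /mu /nu; field.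
  by rewrite w2; field.
have mu0 : mu != 0 by apply: contra_eq_neq mn => ->; rewrite mul0r eq_sym oner_neq0.
have nE : nu = mu^-1 by apply: (mulfI mu0); rewrite mn divff.
exists mu; split => //.
- apply: char_poly_unimodular; first by rewrite -rmorphM divff.
  by rewrite -nE -rmorphD /=; congr (_%:C); rewrite /mu /nu -/t; field.
(* If the modulus were 1, then [mu] would equal its inverse [nu], and the squared trace would be
   [4 * mu ^+ 2 = 4]. *)
- apply: contraTneq t4 => m1; rewrite -leNgt.
  have m2 : mu ^+ 2 = 1 by rewrite -(real_normK (num_real mu)) m1 expr1n.
  have -> : t = mu + nu by rewrite /mu /nu; field.
  have -> : nu = mu by rewrite nE; apply: (mulfI mu0); rewrite divff.
  have -> : (mu + mu) ^+ 2 = 4 * mu ^+ 2 by ring.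
  by rewrite m2 mulr1.
Qed.

End UnimodularMultipliers.

Local Open Scope classical_set_scope.
Local Open Scope ring_scope.

(** * The generating function and the Hessian of the action *)

Section RealDerivatives.
Variable R : realType.
Implicit Types (f g : R -> R) (x a b : R).

Lemma deriv_add f g x a b : is_derive x 1 f a -> is_derive x 1 g b ->
  is_derive x 1 (fun t => f t + g t) (a + b).
Proof. exact: is_deriveD. Qed.

Lemma deriv_opp f x a : is_derive x 1 f a -> is_derive x 1 (fun t => - f t) (- a).
Proof. exact: is_deriveN. Qed.

Lemma deriv_sub f g x a b : is_derive x 1 f a -> is_derive x 1 g b ->
  is_derive x 1 (fun t => f t - g t) (a - b).
Proof. exact: is_deriveB. Qed.

Lemma deriv_mul f g x a b : is_derive x 1 f a -> is_derive x 1 g b ->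
  is_derive x 1 (fun t => f t * g t) (f x * b + g x * a).
Proof. exact: is_deriveM. Qed.

Lemma deriv_inv f x a : f x != 0 -> is_derive x 1 f a ->
  is_derive x 1 (fun t => (f t)^-1) (- a / f x ^+ 2).
Proof.
move=> fx0 df; apply: is_derive_eq (is_deriveV fx0 df) _.
by rewrite /GRing.scale /= mulrC mulNr mulrN.
Qed.

Lemma deriv_sqrt f x a : 0 < f x -> is_derive x 1 f a ->
  is_derive x 1 (fun t => Num.sqrt (f t)) (a / (2 * Num.sqrt (f x))).
Proof.
move=> fx0 df.
have := @is_derive1_comp R Num.sqrt f x _ _ (is_derive1_sqrt fx0) df.
by move/is_derive_eq; apply; rewrite mulrC.
Qed.

Lemma deriv_line f (u al a : R) : is_derive u 1 f a ->
  is_derive (0 : R) 1 (fun t => f (u + t * al)) (al * a).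
Proof.
move=> df.
have l : is_derive (0 : R) 1 (fun t => u + t * al) al.
  have := deriv_add (is_derive_cst u (0 : R) 1)
    (deriv_mul (is_derive_id (0 : R) 1) (is_derive_cst al (0 : R) 1)).
  by move/is_derive_eq; apply; rewrite /=; ring.
have df' : is_derive (u + 0 * al) 1 f a by rewrite mul0r addr0.
have := @is_derive1_comp R f (fun t => u + t * al) 0 _ _ df' l.
by move/is_derive_eq; apply; rewrite mulrC.
Qed.

End RealDerivatives.

Section SlopeIdentities.
Variables (F : numFieldType) (al be l D0 D1 a0 a1 b0 b1 k0 k1 : F).
Hypothesis l0 : l != 0.

Let slope := al * - (- (D0 * a0 + D1 * a1) / l) - be * ((D0 * b0 + D1 * b1) / l).

(** The algebra of the quotient rule. The ends of the chord move with speeds [al] and [be]; [D] is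
    the chord vector, [a] and [b] are the tangents at its ends, [k] is the second derivative of the
    curve at the end concerned, and [slope] is the derivative of the chord length. *)
Lemma chord_slopeE :
  (D0 * (al * a0 - be * b0) + D0 * (al * a0 - be * b0) +
   (D1 * (al * a1 - be * b1) + D1 * (al * a1 - be * b1))) / (2 * l) = slope.
Proof. by rewrite /slope; field. Qed.

Lemma gen1_slopeE :
  - (D0 * a0 + D1 * a1) * (- slope / l ^+ 2) +
  l^-1 * - (D0 * (al * k0) + a0 * (al * a0 - be * b0) +
            (D1 * (al * k1) + a1 * (al * a1 - be * b1))) =
  al * (- (a0 * a0 + a1 * a1 + (D0 * k0 + D1 * k1)) / l +
        (D0 * a0 + D1 * a1) ^+ 2 / l ^+ 3) +
  be * ((a0 * b0 + a1 * b1) / l -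
        (D0 * a0 + D1 * a1) * (D0 * b0 + D1 * b1) / l ^+ 3).
Proof. by rewrite /slope; field. Qed.

Lemma gen2_slopeE :
  (D0 * b0 + D1 * b1) * (- slope / l ^+ 2) +
  l^-1 * (D0 * (be * k0) + b0 * (al * a0 - be * b0) +
          (D1 * (be * k1) + b1 * (al * a1 - be * b1))) =
  al * ((a0 * b0 + a1 * b1) / l -
        (D0 * a0 + D1 * a1) * (D0 * b0 + D1 * b1) / l ^+ 3) +
  be * (- (b0 * b0 + b1 * b1 - (D0 * k0 + D1 * k1)) / l +
        (D0 * b0 + D1 * b1) ^+ 2 / l ^+ 3).
Proof. by rewrite /slope; field. Qed.

End SlopeIdentities.

Section Generating.
Variables (R : realType) (gamma : R -> 'rV[R]_2).
Hypothesis gammaC2 : C2_curve gamma.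
Let T : R -> 'rV[R]_2 := derive1 gamma.
Let K : R -> 'rV[R]_2 := derive1n 2 gamma.

Lemma curve_deriv (s : R) (j : 'I_2) : is_derive s 1 (fun t => gamma t 0 j) (T s 0 j).
Proof.
have [d1 _ _] := gammaC2; have /derivable_mxP d := d1 s.
apply: DeriveDef; first exact: d.
by rewrite /T derive1E derive_mx // mxE.
Qed.

Lemma curve_deriv2 (s : R) (j : 'I_2) : is_derive s 1 (fun t => T t 0 j) (K s 0 j).
Proof.
have [_ d2 _] := gammaC2; have /derivable_mxP d := d2 s.
apply: DeriveDef; first exact: d.
by rewrite /K /derive1n /= derive1E derive_mx // mxE.
Qed.

Definition chord u v : R := enorm (gamma u - gamma v).
(** Closed formulas for the partial derivatives of [gen] of orders one and two; they are identified
    with derivatives off the diagonal, where the chord does not vanish. *)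
Definition gen1 u v := - dot (gamma u - gamma v) (T u) / chord u v.
Definition gen2 u v := dot (gamma u - gamma v) (T v) / chord u v.
Definition gen11 u v := - (dot (T u) (T u) + dot (gamma u - gamma v) (K u)) / chord u v
  + dot (gamma u - gamma v) (T u) ^+ 2 / chord u v ^+ 3.
Definition gen12 u v := dot (T u) (T v) / chord u v
  - dot (gamma u - gamma v) (T u) * dot (gamma u - gamma v) (T v) / chord u v ^+ 3.
Definition gen22 u v := - (dot (T v) (T v) - dot (gamma u - gamma v) (K v)) / chord u v
  + dot (gamma u - gamma v) (T v) ^+ 2 / chord u v ^+ 3.

Lemma dot_ge0 (w : 'rV[R]_2) : 0 <= dot w w.
Proof. by rewrite /dot -!expr2 addr_ge0 ?sqr_ge0. Qed.

Lemma dot_eq0 (w : 'rV[R]_2) : (dot w w == 0) = (w == 0).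
Proof.
apply/eqP/eqP=> [|->]; last by rewrite /dot !mxE; ring.
rewrite /dot -!expr2 => /eqP; rewrite paddr_eq0 ?sqr_ge0 // !sqrf_eq0.
by case/andP=> /eqP w0 /eqP w1; apply/rowP=> j; case: (ord2P j) => ->; rewrite mxE.
Qed.

Lemma chord_gt0 u v : gamma u != gamma v -> 0 < chord u v.
Proof.
move=> uv; rewrite /chord /enorm sqrtr_gt0 lt_neqAle dot_ge0 andbT eq_sym.
by rewrite dot_eq0 subr_eq0.
Qed.

Lemma chord_sqr u v : chord u v ^+ 2 = dot (gamma u - gamma v) (gamma u - gamma v).
Proof. by rewrite /chord /enorm sqr_sqrtr // dot_ge0. Qed.

Section Line.
Variables (u v al be : R).
Hypothesis uv : gamma u != gamma v.
Let U t := u + t * al.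
Let V t := v + t * be.

Let U0 : U 0 = u. Proof. by rewrite /U mul0r addr0. Qed.
Let V0 : V 0 = v. Proof. by rewrite /V mul0r addr0. Qed.

Let D j : is_derive (0 : R) 1 (fun t => gamma (U t) 0 j - gamma (V t) 0 j)
   (al * T u 0 j - be * T v 0 j).
Proof.
by apply: deriv_sub; apply: (@deriv_line _ (fun s => gamma s 0 j)); exact: curve_deriv.
Qed.

Let TU j : is_derive (0 : R) 1 (fun t => T (U t) 0 j) (al * K u 0 j).
Proof. by apply: (@deriv_line _ (fun s => T s 0 j)); exact: curve_deriv2. Qed.

Let TV j : is_derive (0 : R) 1 (fun t => T (V t) 0 j) (be * K v 0 j).
Proof. by apply: (@deriv_line _ (fun s => T s 0 j)); exact: curve_deriv2. Qed.

Let dotE (w w' : 'rV[R]_2) z :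
  dot (w - w') z = (w 0 0 - w' 0 0) * z 0 0 + (w 0 1 - w' 0 1) * z 0 1.
Proof. by rewrite /dot !mxE. Qed.

(** Both ends move at once because a direction in path space shifts every vertex: what the Hessian
    uses are derivatives along lines. *)
Lemma chord_deriv : is_derive (0 : R) 1 (fun t => chord (U t) (V t))
  (al * - gen1 u v - be * gen2 u v).
Proof.
have l0 := chord_gt0 uv.
have := deriv_sqrt _ (deriv_add (deriv_mul (D 0) (D 0)) (deriv_mul (D 1) (D 1))).
rewrite U0 V0 => /(_ _)/is_derive_eq H.
have -> : (fun t => chord (U t) (V t)) = fun x => Num.sqrt
  ((gamma (U x) 0 0 - gamma (V x) 0 0) * (gamma (U x) 0 0 - gamma (V x) 0 0) +
   (gamma (U x) 0 1 - gamma (V x) 0 1) * (gamma (U x) 0 1 - gamma (V x) 0 1)).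
  by apply/funext => t; rewrite /chord /enorm /dot !mxE.
have E : (gamma u 0 0 - gamma v 0 0) * (gamma u 0 0 - gamma v 0 0) +
   (gamma u 0 1 - gamma v 0 1) * (gamma u 0 1 - gamma v 0 1) = chord u v ^+ 2.
  by rewrite chord_sqr /dot !mxE.
apply: H; first by rewrite E exprn_gt0.
rewrite E sqrtr_sqr gtr0_norm // /gen1 /gen2 !dotE.
exact: chord_slopeE (lt0r_neq0 l0).
Qed.

Lemma gen_deriv : is_derive (0 : R) 1 (fun t => gen gamma (U t) (V t))
  (al * gen1 u v + be * gen2 u v).
Proof. have := deriv_opp chord_deriv; move/is_derive_eq; apply; ring. Qed.

Lemma gen1_deriv : is_derive (0 : R) 1 (fun t => gen1 (U t) (V t))
  (al * gen11 u v + be * gen12 u v).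
Proof.
have l0 := chord_gt0 uv.
have := deriv_mul
  (deriv_opp (deriv_add (deriv_mul (D 0) (TU 0)) (deriv_mul (D 1) (TU 1))))
  (deriv_inv _ chord_deriv).
rewrite U0 V0 => /(_ _)/is_derive_eq H.
under eq_fun do rewrite /gen1 dotE.
apply: H; first by rewrite gt_eqF.
rewrite /gen11 /gen12 /gen1 /gen2 !dotE /dot.
exact: gen1_slopeE (lt0r_neq0 l0).
Qed.

Lemma gen2_deriv : is_derive (0 : R) 1 (fun t => gen2 (U t) (V t))
  (al * gen12 u v + be * gen22 u v).
Proof.
have l0 := chord_gt0 uv.
have := deriv_mul (deriv_add (deriv_mul (D 0) (TV 0)) (deriv_mul (D 1) (TV 1)))
    (deriv_inv _ chord_deriv).
rewrite U0 V0 => /(_ _)/is_derive_eq H.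
under eq_fun do rewrite /gen2 dotE.
apply: H; first by rewrite gt_eqF.
rewrite /gen22 /gen12 /gen1 /gen2 !dotE /dot.
exact: gen2_slopeE (lt0r_neq0 l0).
Qed.

End Line.

End Generating.

Lemma is_derive_along (R : realType) (V W : normedModType R) (f : V -> W) (x v : V) df :
  is_derive (0 : R) 1 (fun t : R => f (x + t *: v)) df -> is_derive x v f df.
Proof.
move=> [H <-].
have E : (fun h : R => h^-1 *:
      ((((fun t : R => f (x + t *: v)) \o shift 0) (h *: 1)) - f (x + 0 *: v))) =
    (fun h : R => h^-1 *: ((f \o shift x) (h *: v) - f x)).
  apply/funext => h /=; rewrite scale0r !addr0 [X in f X]addrC.
  by rewrite [h *: 1]mulr1.
by rewrite /derivable /derive E in H *; apply: DeriveDef.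
Qed.

Lemma double_sum_linear (R : pzRingType) (I : finType) (a b c : R)
    (f g h k : I -> I -> R) :
  a * (\sum_j \sum_i f i j) + (b * (\sum_j \sum_i g i j) + b * (\sum_j \sum_i h i j))
    + c * (\sum_j \sum_i k i j) =
  \sum_j \sum_i (a * f i j + (b * g i j + b * h i j) + c * k i j).
Proof.
rewrite !mulr_sumr -!big_split; apply: eq_bigr => j _ /=.
by rewrite !mulr_sumr -!big_split.
Qed.

Section Hessian.
Variables (R : realType) (gamma : R -> 'rV[R]_2).
Hypothesis gammaC2 : C2_curve gamma.

Lemma d1genE u v : gamma u != gamma v -> d1gen gamma u v = gen1 gamma u v.
Proof.
move=> uv; rewrite /d1gen derive1E; apply: derive_val.
apply: is_derive_along; have := gen_deriv gammaC2 1 0 uv.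
have -> : (fun t : R => gen gamma (u + t * 1) (v + t * 0)) =
    (fun t => gen gamma (u + t *: 1) v).
  by apply/funext=> t; rewrite mulr0 addr0.
by move/is_derive_eq; apply; ring.
Qed.

Lemma d2genE u v : gamma u != gamma v -> d2gen gamma u v = gen2 gamma u v.
Proof.
move=> uv; rewrite /d2gen derive1E; apply: derive_val.
apply: is_derive_along; have := gen_deriv gammaC2 0 1 uv.
have -> : (fun t : R => gen gamma (u + t * 0) (v + t * 1)) =
    (fun t => gen gamma u (v + t *: 1)).
  by apply/funext=> t; rewrite mulr0 addr0.
by move/is_derive_eq; apply; ring.
Qed.

Lemma is_derive_sumf n (f : 'I_n -> R -> R) (df : 'I_n -> R) (x : R) :
  (forall i, is_derive x 1 (f i) (df i)) ->
  is_derive x 1 (fun t => \sum_i f i t) (\sum_i df i).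
Proof.
move=> H; have := @is_derive_sum R R R n f x 1 df H.
by congr (is_derive _ _ _ _); apply/funext => t; rewrite fct_sumE.
Qed.

Lemma curve_continuous j : continuous (fun s => gamma s 0 j : R).
Proof.
move=> s; apply/differentiable_continuous/derivable1_diffP.
by have [] := curve_deriv gammaC2 s j.
Qed.

Lemma curve_deriv_continuous j : continuous (fun s => derive1 gamma s 0 j : R).
Proof.
move=> s; apply/differentiable_continuous/derivable1_diffP.
by have [] := curve_deriv2 gammaC2 s j.
Qed.

Variable M : nat.
Implicit Types z v w : 'rV[R]_M.+1.

Definition immersed z := forall k, (k < M)%N ->
  gamma (vertex z k) != gamma (vertex z k.+1).

Lemma vertexD z v (t : R) k : vertex (z + t *: v) k = vertex z k + t * vertex v k.
Proof. by rewrite /vertex !mxE. Qed.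

Lemma path_action_derive z v : immersed z ->
  'D_v (path_action gamma (N := M)) z =
    \sum_(k < M) (vertex v k * gen1 gamma (vertex z k) (vertex z k.+1)
                  + vertex v k.+1 * gen2 gamma (vertex z k) (vertex z k.+1)).
Proof.
move=> zi; apply: derive_val; apply: is_derive_along.
rewrite /path_action; apply: is_derive_sumf => k.
under eq_fun do rewrite !vertexD.
exact: (gen_deriv gammaC2 _ _ (zi k (ltn_ord k))).
Qed.

(** Differentiating a second time at [z] requires the formula for the first derivative on a whole
    neighbourhood. *)
Lemma near_immersed z : immersed z -> \forall y \near z, immersed y.
Proof.
move=> zi.
have H (k : 'I_M) : \forall y \near z, gamma (vertex y k) != gamma (vertex y k.+1).
  pose c j (y : 'rV[R]_M.+1) := gamma (vertex y k) 0 j - gamma (vertex y k.+1) 0 j.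
  have cc j : {for z, continuous (c j)}.
    have cv l : {for z, continuous (fun y : 'rV[R]_M.+1 => gamma (vertex y l) 0 j)}.
      apply: (@continuous_comp _ _ _ (fun y : 'rV[R]_M.+1 => vertex y l)
                (fun s => gamma s 0 j)); last exact: curve_continuous.
      exact: coord_continuous.
    exact: cvgB (cv _) (cv _).
  have [j cj] : exists j, c j z != 0.
    apply/existsP; apply: contraNT (zi k (ltn_ord k)).
    rewrite negb_exists => /forallP cz; apply/eqP/rowP=> j.
    by apply/eqP; rewrite -subr_eq0; have := cz j; rewrite negbK.
  have : \forall y \near z, c j y != 0 by exact: (cvgr_neq0 _ (cc j)).
  apply: filterS => y; apply: contra_neq => e; rewrite /c e subrr //.
have : \forall y \near z, forall k : 'I_M, gamma (vertex y k) != gamma (vertex y k.+1).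
  exact: (@filter_forall _ _ (fun k : 'I_M =>
    [set y | gamma (vertex y k) != gamma (vertex y k.+1)]) _ _ H).
by apply: filterS => y yi k kM; exact: (yi (Ordinal kM)).
Qed.

Lemma path_action_derive2 z v w : immersed z ->
  'D_w ('D_v (path_action gamma (N := M))) z =
        \sum_(k < M)
      (vertex v k * (vertex w k * gen11 gamma (vertex z k) (vertex z k.+1)
                     + vertex w k.+1 * gen12 gamma (vertex z k) (vertex z k.+1))
       + vertex v k.+1 * (vertex w k * gen12 gamma (vertex z k) (vertex z k.+1)
                     + vertex w k.+1 * gen22 gamma (vertex z k) (vertex z k.+1))).
Proof.
move=> zi.
rewrite (@near_eq_derive _ _ _ _ (fun y : 'rV[R]_M.+1 => \sum_(k < M)
  (vertex v k * gen1 gamma (vertex y k) (vertex y k.+1)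
   + vertex v k.+1 * gen2 gamma (vertex y k) (vertex y k.+1)))); last first.
  by near do apply: path_action_derive; exact: near_immersed.
apply: derive_val; apply: is_derive_along; apply: is_derive_sumf => k.
under eq_fun do rewrite !vertexD.
have zk := zi k (ltn_ord k).
have := deriv_add
  (deriv_mul (is_derive_cst (vertex v k) (0 : R) 1)
    (gen1_deriv gammaC2 (vertex w k) (vertex w k.+1) zk))
  (deriv_mul (is_derive_cst (vertex v k.+1) (0 : R) 1)
    (gen2_deriv gammaC2 (vertex w k) (vertex w k.+1) zk)).
by move/is_derive_eq; apply; rewrite !mulr0 !addr0.
Unshelve. all: by end_near. Qed.

Lemma sum_vertex v k : vertex v k = \sum_i v 0 i * vertex (delta_mx 0 i) k.
Proof.
rewrite /vertex; under eq_bigr do rewrite mxE eqxx /= mulrC eq_sym.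
by rewrite sum_indicator.
Qed.

Definition hess_a z k := gen11 gamma (vertex z k) (vertex z k.+1).
Definition hess_b z k := gen12 gamma (vertex z k) (vertex z k.+1).
Definition hess_d z k := gen22 gamma (vertex z k) (vertex z k.+1).

Lemma hess_formE z v w : immersed z ->
    hess_form gamma z v w =
    jacobi_form (hess_a z) (hess_b z) (hess_d z) M (vertex v) (vertex w).
Proof.
move=> zi.
pose e i k := vertex (delta_mx 0 i : 'rV[R]_M.+1) k.
pose q k l i j := v 0 i * (e i k * e j l) * w 0 j.
have P k l : vertex v k * vertex w l = \sum_j \sum_i q k l i j.
  rewrite (sum_vertex v) (sum_vertex w) big_distrlr exchange_big /=.
  by apply: eq_bigr => j _; apply: eq_bigr => i _; rewrite /q /e; ring.
rewrite /hess_form mxE.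
transitivity (\sum_j \sum_i v 0 i * hessian gamma z i j * w 0 j).
  by apply: eq_bigr => j _; rewrite [w^T _ _]mxE mxE mulr_suml.
transitivity (\sum_j \sum_i \sum_(k < M) (hess_a z k * q k k i j
   + (hess_b z k * q k k.+1 i j + hess_b z k * q k.+1 k i j)
   + hess_d z k * q k.+1 k.+1 i j)).
  apply: eq_bigr => j _; apply: eq_bigr => i _.
  rewrite mxE path_action_derive2 // mulr_sumr mulr_suml.
  by apply: eq_bigr => k _; rewrite /hess_a /hess_b /hess_d /q /e; ring.
under eq_bigr do rewrite exchange_big /=.
rewrite exchange_big /=; apply: eq_bigr => k _.
rewrite mulrDr (P k k) (P k k.+1) (P k.+1 k) (P k.+1 k.+1).
exact/esym/double_sum_linear.
Qed.

End Hessian.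

(** * The geometry of the boundary curve *)

Lemma rV2P (R : Type) (v w : 'rV[R]_2) : v 0 0 = w 0 0 -> v 0 1 = w 0 1 -> v = w.
Proof. by move=> e0 e1; apply/rowP => j; case: (ord2P j) => ->. Qed.

Section Boundary.
Variables (R : realType) (len : R) (gamma : R -> 'rV[R]_2).
Hypothesis boundary : billiard_boundary len gamma.
Let T : R -> 'rV[R]_2 := derive1 gamma.
Let K : R -> 'rV[R]_2 := derive1n 2 gamma.
Let n s : 'rV[R]_2 := rot90 (T s).

Let len0 : 0 < len. Proof. by have [] := boundary. Qed.
Let gammaC2 : C2_curve gamma. Proof. by have [] := boundary. Qed.

Lemma curve_eq s t : gamma s = gamma t <-> same_point len s t.
Proof. by have [_ + _ _ _] := boundary; apply. Qed.

Lemma unit_speed s : T s 0 0 ^+ 2 + T s 0 1 ^+ 2 = 1.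
Proof.
have [_ _ _ /(_ s) h _] := boundary.
by rewrite !expr2 -[LHS]/(dot (T s) (T s)) -[LHS]sqr_sqrtr ?dot_ge0 //
  -[Num.sqrt _]/(enorm _) h expr1n.
Qed.

Lemma unit_speed_deriv s : T s 0 0 * K s 0 0 + T s 0 1 * K s 0 1 = 0.
Proof.
have D j := curve_deriv2 gammaC2 s j.
have := deriv_add (deriv_mul (D 0) (D 0)) (deriv_mul (D 1) (D 1)).
have -> : (fun t => derive1 gamma t 0 0 * derive1 gamma t 0 0 +
   derive1 gamma t 0 1 * derive1 gamma t 0 1) = cst (1 : R).
  by apply/funext => t; rewrite -!expr2 unit_speed.
move=> [_ E1]; have := derive_cst (1 : R) s 1; rewrite E1 -/(T s) -/(K s) => h.
have : 2 * (T s 0 0 * K s 0 0 + T s 0 1 * K s 0 1) = 0 by rewrite -[RHS]h; ring.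
by move/eqP; rewrite mulf_eq0 pnatr_eq0 /= => /eqP.
Qed.

Lemma curve_period s (k : int) : gamma (s + k%:~R * len) = gamma s.
Proof. by apply/curve_eq; exists k. Qed.

Lemma derive1_period (V : normedModType R) (f : R -> V) c :
  (forall s, f (s + c) = f s) -> forall s, derive1 f (s + c) = derive1 f s.
Proof.
move=> fc s; rewrite /derive1.
have -> : (fun h => h^-1 *: (f (h + (s + c)) - f (s + c))) =
  (fun h => h^-1 *: (f (h + s) - f s)) by apply/funext => h; rewrite addrA !fc.
by [].
Qed.

Lemma curve_deriv_period s (k : int) : T (s + k%:~R * len) = T s.
Proof. by apply: (@derive1_period _ gamma) => t; exact: curve_period. Qed.

Lemma curve_deriv2_period s (k : int) : K (s + k%:~R * len) = K s.
Proof.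
by apply: (@derive1_period _ (derive1 gamma)) => t; exact: curve_deriv_period.
Qed.

Lemma period_reduce a s : exists k : int, a <= s + k%:~R * len < a + len.
Proof.
exists (- Num.floor ((s - a) / len)).
have /andP[h1 h2] := floor_itv ((s - a) / len).
rewrite mulrNz; set k := (Num.floor _)%:~R in h1 h2 *.
move: h1 h2; rewrite intrD -/k ler_pdivlMr // ltr_pdivrMr // => h1 h2.
by apply/andP; split; lra.
Qed.

(** Carathéodory's form of the derivative. The factor [s - s0] can be divided out exactly, and
    estimates near [s0] become continuity of the quotient at [s0]. *)
Lemma curve_secant s0 : exists h : 'I_2 -> R -> R,
  [/\ forall j s, gamma s 0 j - gamma s0 0 j = h j s * (s - s0),
      forall j, {for s0, continuous (h j)} & forall j, h j s0 = T s0 0 j].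
Proof.
have /choice[h H] : forall j, exists g : R -> R,
    [/\ forall s, gamma s 0 j - gamma s0 0 j = g s * (s - s0),
   {for s0, continuous g} & g s0 = T s0 0 j].
  by move=> j; apply/is_derive1_caratheodory; exact: curve_deriv.
by exists h; split=> j; have [] := H j.
Qed.

(* The excluded vectors form a truncated cone around the inverse normal. *)
Lemma tangent_cone_avoids_curve s (C : R) :
  \forall e \near (0 : R)^'+, forall s' (w := gamma s' - gamma s),
    dot w w < e -> dot w (n s) < 0 -> `|dot w (T s)| <= C * - dot w (n s) -> False.
Proof.
pose P (e s' : R) := let w := gamma s' - gamma s in
  dot w w < e -> dot w (n s) < 0 -> `|dot w (T s)| <= C * - dot w (n s) -> False.
(* Compactness makes the radius [e] uniform along the curve, so it suffices to argue near each [s0],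
   which either represents the point [gamma s] or lies at a positive distance from it. *)
have : \forall e \near (0 : R)^'+, `[0, len]%classic `<=` P e.
    apply: ((compact_near_coveringP `[0, len]%classic).1
    (@segment_compact R 0 len) _ _ P).
  move=> s0 _.
  have [e0|ne0] := pselect (gamma s0 = gamma s).
    have [k sk] := (curve_eq s0 s).1 e0.
    have [h [hE hc hT]] := curve_secant s0.
    pose hn t := h 0 t * n s 0 0 + h 1 t * n s 0 1.
    pose ht t := h 0 t * T s 0 0 + h 1 t * T s 0 1.
    have Ts0 : T s0 = T s by rewrite sk curve_deriv_period.
    have us := unit_speed s.
    have hn0 : hn s0 = 0 by rewrite /hn !hT Ts0 /n /rot90 /vec2 !mxE /=; ring.
    have ht0 : ht s0 = 1 by rewrite /ht !hT Ts0 -us; ring.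
    have hnc : {for s0, continuous hn}.
      by apply: cvgD; apply: cvgM; [exact: hc|exact: cvg_cst|exact: hc|exact: cvg_cst].
    have htc : {for s0, continuous ht}.
      by apply: cvgD; apply: cvgM; [exact: hc|exact: cvg_cst|exact: hc|exact: cvg_cst].
    (* Near the point itself the secant is almost tangent: its normal slope tends to 0 and its
       tangential slope to 1, which leaves the cone. *)
    have N : \forall s' \near s0, C * `|hn s'| < `|ht s'|.
      have : {for s0, continuous (fun t => `|ht t| - C * `|hn t|)}.
        apply: cvgB; first exact: cvg_norm htc.
        by apply: cvgM; [exact: cvg_cst|exact: cvg_norm hnc].
      move/cvgr_gt => /(_ 0); rewrite /= hn0 ht0 normr0 normr1 mulr0 subr0 ltr01.
      by move/(_ isT); apply: filterS => t; rewrite subr_gt0.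
    near=> s' e; rewrite -[P _ _]/(P e s') /P; set w := _ - _ => _ wn0 wT.
    have wE j : w 0 j = h j s' * (s' - s0) by rewrite -hE e0 !mxE.
    have wnE : dot w (n s) = hn s' * (s' - s0) by rewrite /dot !wE /hn; ring.
    have wTE : dot w (T s) = ht s' * (s' - s0) by rewrite /dot !wE /ht; ring.
    have s's0 : 0 < `|s' - s0|.
      by rewrite normr_gt0; apply: contraTneq wn0 => z; rewrite wnE z mulr0 ltxx.
    move: wT; rewrite -(ltr0_norm wn0) wTE wnE !normrM mulrA ler_pM2r // leNgt =>
      /negP[].
    by near: s'.
  (* Far from the point, the truncation does the work: half of the squared distance at [s0] bounds
     [e] from above. *)
  pose f s' := dot (gamma s' - gamma s) (gamma s' - gamma s).
  have f0 : 0 < f s0.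
    by rewrite lt_neqAle dot_ge0 andbT eq_sym dot_eq0 subr_eq0; apply/eqP.
  have fc : {for s0, continuous f}.
    pose g j t := gamma t 0 j - gamma s 0 j.
    have -> : f = fun t => g 0 t * g 0 t + g 1 t * g 1 t.
      by apply/funext => t; rewrite /f /dot !mxE.
    have c j : {for s0, continuous (g j)}.
      by apply: cvgB; [exact: curve_continuous|exact: cvg_cst].
    by apply: cvgD; apply: cvgM; exact: c.
  have f2 : f s0 / 2 < f s0 by rewrite ltr_pdivrMr // ltr_pMr // ltrDr ltr01.
  near=> s' e; rewrite -[P _ _]/(P e s') /P; set w := _ - _ => we; exfalso.
  suff : e <= dot w w by rewrite leNgt we.
  apply: (@le_trans _ _ (f s0 / 2)).
    by near: e; apply: nbhs_right_ltW; rewrite divr_gt0.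
  apply: ltW; rewrite -[dot _ _]/(f s').
  by near: s'; exact: cvgr_gt fc _ f2.
apply: filterS => e Pe s'.
have [k /andP[k0 k1]] := period_reduce 0 s'.
have := Pe (s' + k%:~R * len); rewrite /P curve_period; apply.
by rewrite /= in_itv /= k0 /=; rewrite add0r in k1; exact: ltW.
Unshelve. all: by end_near. Qed.

End Boundary.

Section Inward.
Variables (R : realType) (len : R) (gamma : R -> 'rV[R]_2).
Hypothesis boundary : billiard_boundary len gamma.
Let T : R -> 'rV[R]_2 := derive1 gamma.
Let n s : 'rV[R]_2 := rot90 (T s).

Lemma dotZl c (a b : 'rV[R]_2) : dot (c *: a) b = c * dot a b.
Proof. by rewrite /dot !mxE; ring. Qed.
Lemma dotDl (a a' b : 'rV[R]_2) : dot (a + a') b = dot a b + dot a' b.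
Proof. by rewrite /dot !mxE; ring. Qed.
Lemma dotNl (a b : 'rV[R]_2) : dot (- a) b = - dot a b.
Proof. by rewrite /dot !mxE; ring. Qed.
Lemma dotC (a b : 'rV[R]_2) : dot a b = dot b a.
Proof. by rewrite /dot; ring. Qed.

Lemma segment_is_connected (a b : 'rV[R]_2) : connected (segment a b).
Proof.
apply: connected_continuous_connected; first exact: segment_connected.
apply: continuous_subspaceT => t.
apply: cvgD; apply: cvgZl; last exact: cvg_id.
by apply: cvgB; [exact: cvg_cst|exact: cvg_id].
Qed.

(** A segment off the curve stays in one component of the complement, and being enclosed depends
    only on the component. *)
Lemma table_segment (a b : 'rV[R]_2) :
  (forall c, segment a b c -> ~ range gamma c) -> table gamma a -> table gamma b.
Proof.
move=> sab [ra|[nra bnd]].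
  case: (sab a) => //; exists 0; last by rewrite subr0 scale1r scale0r addr0.
  by rewrite /= in_itv /= lexx ler01.
have bs : segment a b b.
  exists 1; last by rewrite subrr scale1r scale0r add0r.
  by rewrite /= in_itv /= lexx ler01.
have as' : segment a b a.
  exists 0; last by rewrite subr0 scale1r scale0r addr0.
  by rewrite /= in_itv /= lexx ler01.
right; split; first exact: sab.
rewrite -(@same_connected_component _ _ a) //.
by exists (segment a b) => //; split=> //; exact: segment_is_connected.
Qed.

Lemma dot_normal s (w : 'rV[R]_2) : dot w (n s) = w 0 1 * T s 0 0 - w 0 0 * T s 0 1.
Proof. by rewrite /dot /n /rot90 /vec2 !mxE /=; ring. Qed.

(* Otherwise the segment starts in a cone around [- n s] that avoids the curve, so
   its points are in the same component as points known to be outside. *)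
Lemma segment_inward s (d : 'rV[R]_2) t0 : 0 < t0 ->
  (forall t, 0 < t < t0 -> table gamma (gamma s + t *: d)) ->
  dot d (n s) != 0 -> 0 < dot d (n s).
Proof.
move=> t00 dtable dn0; rewrite lt_neqAle eq_sym dn0 /= leNgt; apply/negP => dn.
(* The slope for which [d] lies on the boundary of the cone; by convexity the cone then contains the
   segment from [d] to [- n s], up to scaling. *)
pose C := `|dot d (T s)| / - dot d (n s).
have [e0 e00 H] : exists2 e, 0 < e & forall s' (w := gamma s' - gamma s),
    dot w w < e -> dot w (n s) < 0 -> `|dot w (T s)| <= C * - dot w (n s) -> False.
  have := tangent_cone_avoids_curve boundary s C.
  move/(filterI (nbhs_right_gt (0 : R))) /filter_ex => [e [e0 He]].
  by exists e.
(* An upper bound for the squared length of [(1 - l) *: d - l *: n s], uniform for [l] between 0 and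
   1. *)
pose c := dot d d + 2 * `|dot d (n s)| + 1.
have c0 : 0 < c by rewrite /c ltr_pwDr // addr_ge0 ?dot_ge0 // mulr_ge0.
have [_ _ _ _ /(_ s) orient] := boundary.
near (0 : R)^'+ => t.
have tpos : 0 < t by [].
have [_ ntab] : table gamma (gamma s + t *: n s) /\ ~ table gamma (gamma s - t *: n s).
  by near: t.
have tt0 : t < t0 by near: t; exact: nbhs_right_lt.
have t1 : t < 1 by near: t; exact: nbhs_right_lt.
have te : t * c < e0.
  by rewrite -ltr_pdivlMr //; near: t; apply: nbhs_right_lt; rewrite divr_gt0.
have t2c : t ^+ 2 * c < e0.
  apply: le_lt_trans te; rewrite ler_pM2r // expr2 ger_pMl // ltW //.
apply: ntab; apply: (@table_segment (gamma s + t *: d)); last first.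
  by apply: dtable; rewrite tpos.
have us := unit_speed boundary s.
move=> z [l /=]; rewrite in_itv /= => /andP[l0 l1] <- [s' _ gs'].
have wE : gamma s' - gamma s = t *: ((1 - l) *: d - l *: n s).
  rewrite gs'; apply: rV2P; rewrite !mxE; ring.
have wn : dot (gamma s' - gamma s) (n s) = t * ((1 - l) * dot d (n s) - l).
  rewrite wE !dotZl dotDl dotNl !dotZl; congr (_ * (_ - _)).
  by rewrite dot_normal /n /rot90 /vec2 !mxE /= -[RHS]mulr1 -us; ring.
apply: (H s'); rewrite ?wn.
- apply: le_lt_trans t2c.
  rewrite wE dotZl dotC dotZl mulrA -expr2 ler_pM2l ?exprn_gt0 //.
  rewrite /c.
  have -> : dot ((1 - l) *: d - l *: n s) ((1 - l) *: d - l *: n s) =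
    (1 - l) ^+ 2 * dot d d - 2 * (l * (1 - l)) * dot d (n s) + l ^+ 2 * (T s 0 0 ^+ 2
      + T s 0 1 ^+ 2).
    by rewrite dot_normal /dot /n /rot90 /vec2 !mxE /=; ring.
  rewrite us (ltr0_norm dn); set x := dot d (n s) in dn *; have dd := dot_ge0 d.
  have h1 : 0 <= 1 - (1 - l) ^+ 2 by nra.
  have h2 : 0 <= 1 - l * (1 - l) by nra.
  have h3 : 0 <= - x by rewrite oppr_ge0 ltW.
  have := mulr_ge0 dd h1; have := mulr_ge0 h3 h2; nra.
- rewrite pmulr_rlt0 //; nra.
- rewrite wE dotZl dotDl dotNl !dotZl.
  have -> : dot (n s) (T s) = 0 by rewrite /dot /n /rot90 /vec2 !mxE /=; ring.
  rewrite mulr0 subr0 !normrM (gtr0_norm tpos) (ger0_norm (_ : 0 <= 1 - l)) ?subr_ge0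
    //.
  have -> : `|dot d (T s)| = C * - dot d (n s) by rewrite /C divfK // oppr_eq0.
  have C0 : 0 <= C by rewrite divr_ge0 // oppr_ge0 ltW.
  set x := dot d (n s) in dn *.
  have -> : t * ((1 - l) * (C * - x)) = C * (t * ((1 - l) * - x)) by ring.
  apply: ler_wpM2l => //; rewrite -mulrN ler_pM2l //; nra.
Unshelve. all: by end_near. Qed.

Lemma normal_decomposition s (w : 'rV[R]_2) :
  w = dot w (T s) *: T s + dot w (n s) *: n s.
Proof.
have us := unit_speed boundary s; rewrite dot_normal.
apply: rV2P; rewrite /dot /n /rot90 /vec2 !mxE /=.
  rewrite -[LHS]mulr1 -us; ring.
rewrite -[LHS]mulr1 -us; ring.
Qed.

Lemma admissible_transversal u v s : admissible_segment len gamma u v ->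
  segment (gamma u) (gamma v) (gamma s) -> dot (gamma v - gamma u) (n s) != 0.
Proof.
move=> [_ _ tr] /tr {}tr; apply/eqP => d0.
apply: (tr (dot (gamma v - gamma u) (T s))).
by rewrite [LHS](normal_decomposition s) d0 scale0r addr0.
Qed.

Lemma segmentP (a b c : 'rV[R]_2) :
  segment a b c <-> exists2 t, 0 <= t <= 1 & c = a + t *: (b - a).
Proof.
have E t : (1 - t) *: a + t *: b = a + t *: (b - a).
  by rewrite scalerBl scale1r scalerBr -addrA [- _ + _]addrC.
split=> [[t]|[t t01 ->]]; first by rewrite /= in_itv /= => t01 <-; exists t.
by exists t; rewrite ?E // /= in_itv.
Qed.

Lemma admissible_start u v : admissible_segment len gamma u v ->
  0 < dot (gamma v - gamma u) (n u).
Proof.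
move=> uv; have [_ tab _] := uv; apply: (@segment_inward _ _ 1) => //.
  move=> t /andP[t0 t1]; apply: tab; apply/segmentP; exists t => //.
  by rewrite !ltW.
apply: admissible_transversal uv _; apply/segmentP; exists 0.
  by rewrite lexx ler01.
by rewrite scale0r addr0.
Qed.

Lemma admissible_end u v : admissible_segment len gamma u v ->
  0 < dot (gamma u - gamma v) (n v).
Proof.
move=> uv; have [_ tab _] := uv; apply: (@segment_inward _ _ 1) => //.
  move=> t /andP[t0 t1]; apply: tab; apply/segmentP; exists (1 - t).
    by apply/andP; split; lra.
  by apply: rV2P; rewrite !mxE; ring.
rewrite -opprB dotNl oppr_eq0; apply: admissible_transversal uv _.
apply/segmentP; exists 1; first by rewrite lexx ler01.
by rewrite scale1r addrC subrK.
Qed.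

(** At an interior crossing the segment stays in the table on both sides, so a direction and its
    opposite would both point inwards. *)
Lemma admissible_interior u v s t : admissible_segment len gamma u v ->
  0 < t < 1 -> gamma s <> gamma u + t *: (gamma v - gamma u).
Proof.
move=> uv /andP[t0 t1] gs; have [_ tab _] := uv.
have d0 : dot (gamma v - gamma u) (n s) != 0.
  apply: admissible_transversal uv _; apply/segmentP; exists t => //.
  by rewrite !ltW.
have : 0 < dot (gamma v - gamma u) (n s).
  apply: (@segment_inward _ _ (1 - t)) => //; first by rewrite subr_gt0.
  move=> r /andP[r0 r1]; apply: tab; apply/segmentP; exists (t + r).
    by apply/andP; split; lra.
  by rewrite gs scalerDl addrA.
have : 0 < dot (gamma u - gamma v) (n s).
  apply: (@segment_inward _ _ t) => //; last by rewrite -opprB dotNl oppr_eq0.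
  move=> r /andP[r0 r1]; apply: tab; apply/segmentP; exists (t - r).
    by apply/andP; split; lra.
  by rewrite gs; apply: rV2P; rewrite !mxE; ring.
by rewrite -opprB dotNl oppr_gt0 => /lt_trans h /h; rewrite ltxx.
Qed.

End Inward.

(** * The billiard map along admissible segments *)

Section Step.
Variables (R : realType) (len : R) (gamma : R -> 'rV[R]_2).
Hypothesis boundary : billiard_boundary len gamma.
Let T : R -> 'rV[R]_2 := derive1 gamma.
Let n s : 'rV[R]_2 := rot90 (T s).
Let len0 : 0 < len. Proof. by have [] := boundary. Qed.

Lemma period_unique s (k : int) a :
  a <= s < a + len -> a <= s + k%:~R * len < a + len -> k = 0.
Proof.
move=> /andP[h1 h2] /andP[h3 h4].
have k1 : (k < 1)%R.
  by rewrite -(@ltr_int R) ltNge; apply/negP => ?; have := len0; nra.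
have k2 : (-1 < k)%R.
  by rewrite -(@ltr_int R) ltNge; apply/negP => ?; have := len0; nra.
by lia.
Qed.

Lemma same_point_unique a s t : a < s < a + len -> a < t < a + len ->
  gamma s = gamma t -> s = t.
Proof.
move=> /andP[h1 h2] /andP[h3 h4] /(curve_eq boundary)[k sk].
have k0 : k = 0.
  by apply: (@period_unique t k a); rewrite -?sk !ltW.
by rewrite sk k0 mul0r addr0.
Qed.

Lemma billiard_step_unique p q q' :
  billiard_step len gamma p q -> billiard_step len gamma p q' -> q = q'.
Proof.
move=> [_ q0 [t [t0 qt ft]] q1] [_ q'0 [t' [t'0 q't ft']] q'1].
have tt' : t = t'.
  case: (ltgtP t t') => // [lt|lt].
    by case: (ft' t); [rewrite t0|exists (q 0 0)].
  by case: (ft t'); [rewrite t'0|exists (q' 0 0)].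
have e0 : q 0 0 = q' 0 0.
  by apply: (same_point_unique q0 q'0); rewrite qt q't tt'.
by apply: rV2P; [exact: e0|rewrite q1 q'1 e0].
Qed.

Lemma billiard_mapE p q : billiard_step len gamma p q -> billiard_map len gamma p = q.
Proof.
move=> pq; apply: xget_unique => // q' pq'.
exact: billiard_step_unique pq' pq.
Qed.

Section AdmissibleStep.
Variables (u v : R).
Hypothesis uv : admissible_segment len gamma u v.

Lemma admissible_neq : gamma u != gamma v.
Proof. by have [h _ _] := uv; apply/eqP => /(curve_eq boundary). Qed.

Let l := chord gamma u v.
Let l0 : 0 < l. Proof. exact: chord_gt0 admissible_neq. Qed.

(** Sines of the angles between the chord and the curve at its ends, positive because the chord
    points inwards at both. *)
Definition sin_start := dot (gamma v - gamma u) (n u) / chord gamma u v.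
Definition sin_end := dot (gamma u - gamma v) (n v) / chord gamma u v.

Lemma sin_start_gt0 : 0 < sin_start.
Proof. by rewrite divr_gt0 ?(admissible_start boundary). Qed.

Lemma sin_end_gt0 : 0 < sin_end.
Proof. by rewrite divr_gt0 ?(admissible_end boundary). Qed.

Let pythagoras s (w : 'rV[R]_2) : dot w w = dot w (T s) ^+ 2 + dot w (n s) ^+ 2.
Proof.
have us := unit_speed boundary s; rewrite -/T in us.
have -> : dot w w = dot w w * (T s 0 0 ^+ 2 + T s 0 1 ^+ 2) by rewrite us mulr1.
rewrite dot_normal /dot -/T; ring.
Qed.

Lemma sin_start_sqr : sin_start ^+ 2 = 1 - gen1 gamma u v ^+ 2.
Proof.
have := pythagoras u (gamma u - gamma v); rewrite -chord_sqr -/l => e.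
rewrite /sin_start /gen1 -/l -/T -[gamma v - _]opprB dotNl !expr_div_n !sqrrN.
have : l ^+ 2 != 0 by rewrite sqrf_eq0 gt_eqF.
by move=> ?; apply: (canLR (mulfK _)) => //; rewrite mulrBl divfK // mul1r e; ring.
Qed.

Lemma sin_end_sqr : sin_end ^+ 2 = 1 - gen2 gamma u v ^+ 2.
Proof.
have := pythagoras v (gamma u - gamma v); rewrite -chord_sqr -/l => e.
rewrite /sin_end /gen2 -/l -/T !expr_div_n.
have : l ^+ 2 != 0 by rewrite sqrf_eq0 gt_eqF.
by move=> ?; apply: (canLR (mulfK _)) => //; rewrite mulrBl divfK // mul1r e; ring.
Qed.

(** The unit chord has tangential component [gen1] and normal component [sin_start]; positivity of
    the latter selects the square root taken in [outgoing]. The parameter [u'] is any lift of the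
    same point. *)
Lemma outgoing_chord u' : gamma u' = gamma u -> T u' = T u ->
  outgoing gamma (vec2 u' (- gen1 gamma u v)) = l^-1 *: (gamma v - gamma u).
Proof.
move=> gu Tu; rewrite /outgoing /vec2 !mxE /= -/(T u') Tu opprK sqrrN -sin_start_sqr.
rewrite sqrtr_sqr gtr0_norm ?sin_start_gt0 // [in RHS](normal_decomposition boundary
  u (gamma v - gamma u)).
rewrite scalerDr !scalerA /sin_start /gen1 -/T -/n -/l -[gamma u - _]opprB dotNl opprK.
by rewrite ![l^-1 * _]mulrC.
Qed.

Lemma admissible_billiard_step u' w : gamma u' = gamma u -> T u' = T u ->
  u' < w < u' + len -> gamma w = gamma v -> T w = T v ->
  billiard_step len gamma (vec2 u' (- gen1 gamma u v)) (vec2 w (gen2 gamma u v)).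
Proof.
move=> gu Tu uw gw Tw.
have lN0 : l != 0 := lt0r_neq0 l0.
have oE := outgoing_chord gu Tu.
split; rewrite ?oE.
- rewrite /vec2 mxE /=; have := sin_start_sqr; have := sin_start_gt0.
  by move: sin_start (gen1 _ _ _) => s g s0 s2; apply/andP; split; nra.
- by rewrite /vec2 !mxE.
- have u0 : (vec2 u' (- gen1 gamma u v)) 0 0 = u' by rewrite /vec2 mxE.
  have w0 : (vec2 w (gen2 gamma u v)) 0 0 = w by rewrite /vec2 mxE.
  rewrite u0 w0 gu gw; exists l; split.
  + exact: l0.
  + by rewrite scalerA (divff lN0) scale1r addrC subrK.
  + move=> r /andP[r0 rl] [s' _]; rewrite scalerA.
    have r01 : 0 < r / l < 1 by rewrite (divr_gt0 r0 l0) /= ltr_pdivrMr // mul1r.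
    exact: (admissible_interior boundary uv r01).
- have w0 : (vec2 w (gen2 gamma u v)) 0 0 = w by rewrite /vec2 mxE.
  rewrite w0 -/(T w) Tw dotZl [LHS]mxE /= /gen2 -/l -/T -[gamma v - _]opprB dotNl.
  by rewrite mulrN opprK mulrC.
Qed.

End AdmissibleStep.

End Step.

Definition cross (R : pzRingType) (a b : 'rV[R]_2) : R := a 0 0 * b 0 1 - a 0 1 * b 0 0.

Lemma ball_between (R : realFieldType) (s s' c s0 del : R) :
  `|s - s0| < del -> `|s' - s0| < del -> s < c -> c < s' -> `|s0 - c| < del.
Proof. by rewrite !ltr_norml => /andP[? ?] /andP[? ?] ? ?; apply/andP; split; lra. Qed.

(** * Persistence of a transversal first hit under perturbation of the phase point *)

Section NearStep.
Variables (R : realType) (len : R) (gamma : R -> 'rV[R]_2).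
Hypothesis boundary : billiard_boundary len gamma.
Let T : R -> 'rV[R]_2 := derive1 gamma.
Let gammaC2 : C2_curve gamma. Proof. by have [] := boundary. Qed.
Let o : 'rV[R]_2 -> 'rV[R]_2 := outgoing gamma.
Implicit Types (p : 'rV[R]_2) (s : R).

Lemma outgoing0 (p : 'rV[R]_2) : o p 0 0 = - p 0 1 * T (p 0 0) 0 0 - Num.sqrt (1 - p
  0 1 ^+ 2) * T (p 0 0) 0 1.
Proof. by rewrite /o /outgoing /rot90 /vec2 !mxE /= -/T; ring. Qed.

Lemma outgoing1 (p : 'rV[R]_2) : o p 0 1 = - p 0 1 * T (p 0 0) 0 1 + Num.sqrt (1 - p
  0 1 ^+ 2) * T (p 0 0) 0 0.
Proof. by rewrite /o /outgoing /rot90 /vec2 !mxE /= -/T; ring. Qed.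

Lemma outgoing_unit (p : 'rV[R]_2) : -1 < p 0 1 < 1 -> o p 0 0 ^+ 2 + o p 0 1 ^+ 2 = 1.
Proof.
move=> /andP[h1 h2]; have us := unit_speed boundary (p 0 0); rewrite -/T in us.
have s2 : Num.sqrt (1 - p 0 1 ^+ 2) ^+ 2 = 1 - p 0 1 ^+ 2 by rewrite sqr_sqrtr //; nra.
rewrite outgoing0 outgoing1; set s := Num.sqrt _ in s2 *.
transitivity ((p 0 1 ^+ 2 + s ^+ 2) * (T (p 0 0) 0 0 ^+ 2 + T (p 0 0) 0 1 ^+ 2));
  first by ring.
by rewrite us s2; ring.
Qed.

Lemma cross_outgoing_start p : cross (o p) (T (p 0 0)) = - Num.sqrt (1 - p 0 1 ^+ 2).
Proof.
have us := unit_speed boundary (p 0 0); rewrite -/T in us.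
rewrite /cross outgoing0 outgoing1 -[RHS]mulr1 -us; ring.
Qed.

Lemma outgoing_continuous j : continuous (fun p => o p 0 j : R).
Proof.
move=> p.
have c0 : {for p, continuous (fun p : 'rV[R]_2 => p 0 0 : R)}
  by exact: coord_continuous.
have c1 : {for p, continuous (fun p : 'rV[R]_2 => p 0 1 : R)}
  by exact: coord_continuous.
have cT i : {for p, continuous (fun p : 'rV[R]_2 => T (p 0 0) 0 i : R)}.
  apply: (@continuous_comp _ _ _ (fun p : 'rV[R]_2 => p 0 0) (fun s => T s 0 i)) => //.
  exact: curve_deriv_continuous.
have cs : {for p, continuous (fun p : 'rV[R]_2 => Num.sqrt (1 - p 0 1 ^+ 2) : R)}.
  apply: (@continuous_comp _ _ _ (fun p : 'rV[R]_2 => 1 - p 0 1 ^+ 2) (@Num.sqrt R)).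
    have c2 : {for p, continuous (fun p : 'rV[R]_2 => p 0 1 ^+ 2 : R)}
      by exact: (cvgM c1 c1).
    have cc : {for p, continuous (fun=> 1 : R)} by exact: cst_continuous.
    exact: (continuousB cc c2).
  exact: sqrt_continuous.
have cN : {for p, continuous (fun p : 'rV[R]_2 => - p 0 1 : R)} by exact: (cvgN c1).
case: (ord2P j) => ->.
  rewrite (_ : (fun p => _) = (fun p =>
    - p 0 1 * T (p 0 0) 0 0 - Num.sqrt (1 - p 0 1 ^+ 2) * T (p 0 0) 0 1)).
    exact: (continuousB (continuousM cN (cT 0)) (continuousM cs (cT 1))).
  by apply/funext => ?; rewrite outgoing0.
rewrite (_ : (fun p => _) = (fun p =>
  - p 0 1 * T (p 0 0) 0 1 + Num.sqrt (1 - p 0 1 ^+ 2) * T (p 0 0) 0 0)).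
  exact: (continuousD (continuousM cN (cT 1)) (continuousM cs (cT 0))).
by apply/funext => ?; rewrite outgoing1.
Qed.

(** Orthogonal coordinates of [gamma s] relative to the ray from [p]: the signed distance to its
    line, and below it the position along the line. A hit is a zero of the defect with positive
    length. *)
Definition ray_defect (p : 'rV[R]_2) s : R := cross (o p) (gamma s - gamma (p 0 0)).
Definition ray_length (p : 'rV[R]_2) s : R := dot (gamma s - gamma (p 0 0)) (o p).

Let oc j z : {for z, continuous (fun z : 'rV[R]_2 * R => o z.1 0 j)}.
Proof.
apply: (@continuous_comp _ _ _ fst (fun p => o p 0 j)); first exact: cvg_fst.
exact: outgoing_continuous.
Qed.

Let Tc j z : {for z, continuous (fun z : 'rV[R]_2 * R => T z.2 0 j)}.
Proof.
apply: (@continuous_comp _ _ _ snd (fun s => T s 0 j)); first exact: cvg_snd.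
exact: curve_deriv_continuous.
Qed.

Let xc z : {for z, continuous (fun z : 'rV[R]_2 * R => z.1 0 0 : R)}.
Proof.
apply: (@continuous_comp _ _ _ fst (fun p : 'rV[R]_2 => p 0 0)); first exact: cvg_fst.
exact: coord_continuous.
Qed.

Let gc j z : {for z, continuous (fun z : 'rV[R]_2 * R =>
  (gamma z.2 - gamma (z.1 0 0)) 0 j)}.
Proof.
rewrite (_ : (fun z => _) = (fun z : 'rV[R]_2 * R =>
  gamma z.2 0 j - gamma (z.1 0 0) 0 j)); last first.
  by apply/funext => ?; rewrite !mxE.
apply: cvgB.
  apply: (@continuous_comp _ _ _ snd (fun s => gamma s 0 j)); first exact: cvg_snd.
  exact: curve_continuous.
apply: (@continuous_comp _ _ _ (fun z : 'rV[R]_2 * R => z.1 0 0) (fun s =>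
  gamma s 0 j)).
  exact: xc.
exact: curve_continuous.
Qed.

Lemma ray_defect_continuous : continuous (fun z : 'rV[R]_2 * R => ray_defect z.1 z.2).
Proof. by move=> z; apply: cvgB; apply: cvgM;
  [exact: oc|exact: gc|exact: oc|exact: gc]. Qed.

Lemma ray_length_continuous : continuous (fun z : 'rV[R]_2 * R => ray_length z.1 z.2).
Proof. by move=> z; apply: cvgD; apply: cvgM;
  [exact: gc|exact: oc|exact: gc|exact: oc]. Qed.

Lemma ray_defect_continuousl s : continuous (fun p => ray_defect p s : R).
Proof.
move=> p; apply: (@continuous_comp _ _ _ (fun p : 'rV[R]_2 => (p, s))
  (fun z : 'rV[R]_2 * R => ray_defect z.1 z.2)).
  by apply: (@cvg_pair _ _ _ (nbhs p) (nbhs p) (nbhs s));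
    [exact: cvg_id|exact: cvg_cst].
exact: ray_defect_continuous.
Qed.

Lemma ray_defect_continuousr p : continuous (fun s => ray_defect p s : R).
Proof.
move=> s; apply: (@continuous_comp _ _ _ (fun s : R => (p, s))
  (fun z : 'rV[R]_2 * R => ray_defect z.1 z.2)).
  by apply: (@cvg_pair _ _ _ (nbhs s) (nbhs p) (nbhs s));
    [exact: cvg_cst|exact: cvg_id].
exact: ray_defect_continuous.
Qed.

Lemma cross_tangent_continuous : continuous (fun z : 'rV[R]_2 * R =>
  cross (o z.1) (T z.2)).
Proof. by move=> z; apply: cvgB; apply: cvgM;
  [exact: oc|exact: Tc|exact: oc|exact: Tc]. Qed.

Lemma ray_defect0 p s : -1 < p 0 1 < 1 -> ray_defect p s = 0 ->
  gamma s = gamma (p 0 0) + ray_length p s *: o p.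
Proof.
move=> py; have ou := outgoing_unit py; rewrite /ray_defect /ray_length /cross /dot.
set w := gamma s - _ => d0.
have -> : gamma s = gamma (p 0 0) + w by rewrite /w addrC subrK.
congr (_ + _); apply: rV2P; rewrite [RHS]mxE -[LHS]mulr1 -ou.
  transitivity ((w 0 0 * o p 0 0 + w 0 1 * o p 0 1) * o p 0 0
    - o p 0 1 * (o p 0 0 * w 0 1 - o p 0 1 * w 0 0)); first by ring.
  by rewrite d0; ring.
transitivity ((w 0 0 * o p 0 0 + w 0 1 * o p 0 1) * o p 0 1
    + o p 0 0 * (o p 0 0 * w 0 1 - o p 0 1 * w 0 0)); first by ring.
by rewrite d0; ring.
Qed.

Lemma ray_hit p s r : -1 < p 0 1 < 1 -> gamma s = gamma (p 0 0) + r *: o p ->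
  ray_defect p s = 0 /\ ray_length p s = r.
Proof.
move=> py; have ou := outgoing_unit py => gs.
have e j : (gamma s - gamma (p 0 0)) 0 j = r * o p 0 j.
  by rewrite gs addrAC subrr add0r mxE.
rewrite /ray_defect /ray_length /cross /dot !e; split; first by ring.
by rewrite -[RHS]mulr1 -ou; ring.
Qed.

(** [cross (o p) (T s)] is the derivative of the defect in [s]. It stays nonzero near [(p0, s0)],
    and the mean value theorem gives injectivity with a radius independent of [p]. *)
Lemma transversal_injective p0 s0 : cross (o p0) (T s0) != 0 ->
  exists2 del, 0 < del & \forall p \near p0, forall s s',
    `|s - s0| < del -> `|s' - s0| < del -> ray_defect p s = ray_defect p s' -> s = s'.
Proof.
move=> c0.
have : \forall z \near (p0, s0), cross (o z.1) (T z.2) != 0.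
  exact: (cvgr_neq0 _ (@cross_tangent_continuous (p0, s0))).
move=> [[A B] /= [Ap Bs] AB].
have [del /= del0 Bdel] := (nbhs_ballP _ _).1 Bs.
exists del => //; apply: filterS Ap => p Ap s s' ss ss' d.
wlog lt : s s' ss ss' d / s < s'.
  move=> W; case: (ltgtP s s') => // lt; first exact: W.
  by symmetry; apply: W.
have D (x : R) : is_derive x 1 (ray_defect p) (cross (o p) (T x)).
  have Dj j := curve_deriv gammaC2 x j.
  have := deriv_sub (deriv_mul (is_derive_cst (o p 0 0) x 1) (deriv_sub (Dj 1)
    (is_derive_cst (gamma (p 0 0) 0 1) x 1)))
     (deriv_mul (is_derive_cst (o p 0 1) x 1) (deriv_sub (Dj 0) (is_derive_cst (gamma
       (p 0 0) 0 0) x 1))).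
  have <- : ray_defect p = (fun t : R => o p 0 0 * (gamma t 0 1 - gamma (p 0 0) 0 1) -
    o p 0 1 * (gamma t 0 0 - gamma (p 0 0) 0 0)).
    by apply/funext => t; rewrite /ray_defect /cross !mxE.
  by move/is_derive_eq; apply; rewrite /cross /= /T; ring.
have [c cI] : exists2 c, c \in `]s,
  s'[%R & ray_defect p s' - ray_defect p s = cross (o p) (T c) * (s' - s).
  apply: MVT => //; apply: derivable_within_continuous => x _.
  by have [] := D x.
rewrite d subrr => /esym/eqP; rewrite mulf_eq0 [X in _ || X]gt_eqF ?subr_gt0 // orbF
  => /eqP z.
suff : cross (o p) (T c) != 0 by rewrite z eqxx.
apply: (AB (p, c)); split=> //=; apply: Bdel; rewrite -ball_normE /=.
by move: cI; rewrite in_itv /= => /andP[c1 c2]; exact: (ball_between ss ss').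
Qed.

Section Near.
Variables (p0 q0 : 'rV[R]_2).
Hypothesis step : billiard_step len gamma p0 q0.
Hypothesis exits : cross (o p0) (T (q0 0 0)) != 0.
Let X0 := q0 0 0.

Let y0 : -1 < p0 0 1 < 1. Proof. by have [] := step. Qed.

Let hitX0 : ray_defect p0 X0 = 0 /\ 0 < ray_length p0 X0.
Proof.
have [_ _ [t [t0 gt _]] _] := step.
by have [-> ->] := ray_hit y0 gt.
Qed.

Let start_transversal : cross (o p0) (T (p0 0 0)) != 0.
Proof.
rewrite cross_outgoing_start oppr_eq0 gt_eqF // sqrtr_gt0.
by move: y0 => /andP[? ?]; nra.
Qed.

(** The defect of [p0] changes sign at [X0]; its signs at [X0 - e] and [X0 + e] persist for nearby
    [p], and the intermediate value theorem applies. The factor [k X0] makes the signs independent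
    of the side from which the ray crosses. *)
Lemma near_ray_root eta : 0 < eta ->
  \forall p \near p0, exists2 s, `|s - X0| < eta & ray_defect p s = 0.
Proof.
move=> eta0.
have [h [hE hc hT]] := curve_secant boundary X0.
pose k s := o p0 0 0 * h 1 s - o p0 0 1 * h 0 s.
have dE s : ray_defect p0 s = k s * (s - X0).
  have [d0 _] := hitX0; rewrite -[LHS]subr0 -d0 /ray_defect /cross /k.
  have e j : h j s * (s - X0) = gamma s 0 j - gamma X0 0 j by rewrite hE.
  have -> : (o p0 0 0 * h 1 s - o p0 0 1 * h 0 s) * (s - X0) =
    o p0 0 0 * (h 1 s * (s - X0)) - o p0 0 1 * (h 0 s * (s - X0)) by ring.
  rewrite !e.
  have m u j : (gamma u - gamma (p0 0 0)) 0 j = gamma u 0 j - gamma (p0 0 0) 0 j.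
    by rewrite !mxE.
  by rewrite !m; ring.
have kc : {for X0, continuous k}.
  have c j c : {for X0, continuous (fun s => c * h j s)}.
    by apply: cvgM; [exact: cvg_cst|exact: hc].
  exact: continuousB (c _ _) (c _ _).
have k0 : k X0 != 0 by rewrite /k !hT; exact: exits.
have : \forall s \near X0, 0 < k s * k X0.
  have kk : {for X0, continuous (fun s => k s * k X0)}.
    by apply: cvgM; [exact: kc|exact: cvg_cst].
  apply: (cvgr_gt _ kk); rewrite -expr2 lt_neqAle sqr_ge0 eq_sym sqrf_eq0 k0 //.
move=> /nbhs_ballP[del /= del0 Hdel].
pose e := Num.min del eta / 2.
have e0 : 0 < e by rewrite divr_gt0 // lt_min del0.
have edel : e < del.
  by rewrite (@lt_le_trans _ _ (Num.min del eta)) ?ge_min ?lexx // ltr_pdivrMr //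
    ltr_pMr ?lt_min ?del0 // ltrDl ltr01.
have eeta : e < eta.
  by rewrite (@lt_le_trans _ _ (Num.min del eta)) ?ge_min ?lexx ?orbT // ltr_pdivrMr
    // ltr_pMr ?lt_min ?del0 // ltrDl ltr01.
have dc s : {for p0, continuous (fun p => ray_defect p s * k X0 : R)}.
  have c1 : {for p0, continuous (fun p => ray_defect p s : R)}.
    exact: ray_defect_continuousl.
  have c2 : {for p0, continuous (fun=> k X0 : R)} by exact: cst_continuous.
  exact: (continuousM c1 c2).
have Np : \forall p \near p0, 0 < ray_defect p (X0 + e) * k X0.
  apply: (cvgr_gt _ (dc (X0 + e))).
  rewrite dE addrAC subrr add0r mulrAC mulr_gt0 //; apply: Hdel.
  by rewrite -ball_normE /= opprD addNKr normrN gtr0_norm.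
have Nm : \forall p \near p0, ray_defect p (X0 - e) * k X0 < 0.
  apply: (cvgr_lt _ (dc (X0 - e))).
  rewrite dE addrAC subrr add0r mulrAC mulrN oppr_lt0 mulr_gt0 //; apply: Hdel.
  by rewrite -ball_normE /= opprB addrC subrK gtr0_norm.
near=> p.
have P1 : 0 < ray_defect p (X0 + e) * k X0 by near: p.
have P2 : ray_defect p (X0 - e) * k X0 < 0 by near: p.
have [c cI c0] : exists2 c, c \in `[X0 - e, X0 + e] & ray_defect p c = 0.
  apply: IVT; first by lra.
    by apply: continuous_subspaceT; exact: ray_defect_continuousr.
  rewrite ge_min le_max; have [kpos|kneg|kz] := ltgtP 0 (k X0).
  - by move: P1 P2; rewrite pmulr_lgt0 // pmulr_llt0 // => /ltW -> /ltW ->;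
    rewrite orbT.
  - by move: P1 P2; rewrite nmulr_lgt0 // nmulr_llt0 // => /ltW -> /ltW ->;
    rewrite orbT.
  - by rewrite -kz eqxx in k0.
exists c => //; move: cI; rewrite in_itv /= => /andP[c1 c2].
by rewrite ltr_norml; apply/andP; split; lra.
Unshelve. all: by end_near. Qed.

(** The covering form of compactness works with the filter of pairs [(s, z)]; this fact and the next
    carry statements near [(p0, s0)] or [(p0, X0)] over to it. *)
Let near_swap s0 (Q : 'rV[R]_2 -> R -> Prop) : (\forall z \near (p0, s0), Q z.1 z.2) ->
  \forall s \near s0 & z \near (p0, X0), Q z.1 s.
Proof.
move=> [[A B] /= [Ap Bs] AB].
exists (B, [set z | A z.1]); first by split=> //=;
  exact: (@cvg_fst _ _ (nbhs p0) (nbhs X0) _ _ Ap).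
by move=> [s z] [/= Bs' Az]; apply: (AB (z.1, s)).
Qed.

Let near_lift s0 (Q : 'rV[R]_2 * R -> Prop) : (\forall z \near (p0, X0), Q z) ->
  \forall s \near s0 & z \near (p0, X0), Q z.
Proof.
move=> HQ; exists (setT, Q); first by split=> //=; exact: filterT.
by move=> [s z] [_ Qz].
Qed.

(* Compactness of the curve: every other intersection of the perturbed ray with the
   curve is behind the starting point or beyond the perturbed hitting point. *)
Lemma near_first_hit del : 0 < del -> \forall z \near (p0, X0), forall s,
  ray_defect z.1 s = 0 -> 0 < ray_length z.1 s ->
  ray_length z.1 z.2 <= ray_length z.1 s \/ exists k : int,
    `|s + k%:~R * len - X0| < del.
Proof.
move=> del0.
pose P (z : 'rV[R]_2 * R) s := ray_defect z.1 s = 0 -> 0 < ray_length z.1 s ->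
  ray_length z.1 z.2 <= ray_length z.1 s \/ exists k : int,
    `|s + k%:~R * len - X0| < del.
suff : \forall z \near (p0, X0), `[0, len]%classic `<=` P z.
  apply: filterS => z Pz s ds ls.
  have [k /andP[k0 k1]] := period_reduce boundary 0 s.
  have gk := curve_period boundary s k.
  have := Pz (s + k%:~R * len); rewrite /P /ray_defect /ray_length gk.
  case=> //; first by rewrite /= in_itv /= k0 /=; rewrite add0r in k1; exact: ltW.
    by left.
  by move=> [k' hk']; right; exists (k + k'); rewrite intrD mulrDl addrA.
apply: ((compact_near_coveringP `[0, len]%classic).1 (@segment_compact R 0 len)
  ('rV[R]_2 * R)%type (nbhs (p0, X0)) P (nbhs_filter _)).
move=> s0 _.
have [d0|dn0] := eqVneq (ray_defect p0 s0) 0; last first.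
  have : \forall z \near (p0, s0), ray_defect z.1 z.2 != 0.
    exact: (cvgr_neq0 _ (@ray_defect_continuous (p0, s0))).
  move/(near_swap (Q := fun p s => ray_defect p s != 0)); apply: filterS => -[s z] /= h.
  by rewrite /P => h'; rewrite h' eqxx in h.
have gs := ray_defect0 y0 d0.
have [_ _ [t0 [t00 gX0 free]] _] := step.
have lX0 : ray_length p0 X0 = t0 by have [] := ray_hit y0 gX0.
set r := ray_length p0 s0 in gs.
(* Position of [gamma s0] on the unperturbed ray: behind the start; before the first hit, which is
   excluded; beyond the hit; at the hit, up to a period; or at the start itself. *)
have [r0|r0|r0] := ltgtP r 0.
- have : \forall z \near (p0, s0), ray_length z.1 z.2 < 0.
    exact: (cvgr_lt _ (@ray_length_continuous (p0, s0))).
  move/(near_swap (Q := fun p s => ray_length p s < 0)); apply: filterS => -[s z] /= h.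
  by rewrite /P => _ h'; move: (lt_trans h h'); rewrite ltxx.
- have [rt|rt|rt] := ltgtP r t0.
  + by case: (free r); [rewrite r0 rt|exists s0].
  + pose m := (r + t0) / 2.
    have mr : m < r by rewrite /m; lra.
    have tm : t0 < m by rewrite /m; lra.
    have : \forall z \near (p0, s0), m < ray_length z.1 z.2.
      exact: (cvgr_gt _ (@ray_length_continuous (p0, s0))).
    move/(near_swap (Q := fun p s => m < ray_length p s)) => h1.
    have : \forall z \near (p0, X0), ray_length z.1 z.2 < m.
      by apply: (cvgr_lt _ (@ray_length_continuous (p0, X0))); rewrite /= lX0.
    move/(near_lift s0) => h2.
    apply: filterS (filterI h1 h2) => -[s z] /= [h h'].
    by rewrite /P => _ _; left; exact: ltW (lt_trans h' h).
  + have gE : gamma X0 = gamma s0 by rewrite gs rt gX0.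
    have [k kE] := (curve_eq boundary _ _).1 gE.
    have : \forall z \near (p0, s0), `|z.2 - s0| < del.
      exists (setT, ball s0 del); first by split=> /=;
        [exact: filterT|exact: nbhsx_ballx].
      by move=> [p s] [_ /=]; rewrite -ball_normE /= distrC.
    move/(near_swap (Q := fun p s => `|s - s0| < del)); apply: filterS => -[s z] /= h.
    rewrite /P => _ _; right; exists k; rewrite kE opprD addrACA subrr addr0 //.
(* At the start the sign of the length is not stable. But the perturbed starting point is itself a
   zero of the defect, by transversality the only one nearby, and its length is 0. *)
- have gE : gamma s0 = gamma (p0 0 0) by rewrite gs r0 scale0r addr0.
  have [k kE] := (curve_eq boundary _ _).1 gE.
  have [d1 d10 inj] := transversal_injective start_transversal.
  have h1 : \forall s \near s0 & z \near (p0, X0), `|s - s0| < d1.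
    apply: (near_swap (Q := fun p s => `|s - s0| < d1)).
    exists (setT, ball s0 d1); first by split=> /=; [exact: filterT|exact: nbhsx_ballx].
    by move=> [p s] [_ /=]; rewrite -ball_normE /= distrC.
  pose Q (z : 'rV[R]_2 * R) := (`|z.1 0 0 - p0 0 0| < d1) /\
     forall s s', `|s - p0 0 0| < d1 -> `|s' - p0 0 0| < d1 ->
       ray_defect z.1 s = ray_defect z.1 s' -> s = s'.
  have h2 : \forall s \near s0 & z \near (p0, X0), Q z.
    apply: near_lift.
    have c : \forall p \near p0, `|(p : 'rV[R]_2) 0 0 - p0 0 0| < d1.
      have : {for p0, continuous (fun p => p 0 0 : R)} by exact: coord_continuous.
      move/cvgrPdist_lt => /(_ _ d10); apply: filterS => p; rewrite distrC //.
    eexists (_, setT); first by split=> /=; [exact: (filterI c inj)|exact: filterT].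
    by move=> [p s] [[? ?] _]; split.
  apply: filterS (filterI h1 h2) => -[s z] /= [h [hx hinj]].
  rewrite /P => ds ls; exfalso.
  have sx : s + (- k)%:~R * len = z.1 0 0.
    apply: hinj => //.
      by move: h; rewrite kE mulrNz; congr (`|_| < _); ring.
    by rewrite /ray_defect curve_period // -/(ray_defect _ _) ds /cross subrr !mxE;
      ring.
  move: ls; rewrite /ray_length -(curve_period boundary s (- k)) sx subrr.
  by rewrite /dot !mxE; lra.
Qed.

(** The root found near [X0] is the first hit: an earlier one would also lie near [X0] up to a
    period, where the defect has a single zero. *)
Lemma near_billiard_step eps : 0 < eps ->
  \forall p \near p0, exists2 q, billiard_step len gamma p q & `|q 0 0 - X0| < eps.
Proof.
move=> eps0.
have [d2 d20 inj] := transversal_injective exits.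
have [d0 l0] := hitX0.
have [_ q0b _ _] := step; rewrite -/X0 in q0b.
have H1 := near_first_hit d20.
have H2 : \forall z \near (p0, X0), 0 < ray_length z.1 z.2.
  exact: (cvgr_gt _ (@ray_length_continuous (p0, X0))).
have H3 : \forall z \near (p0, X0), 0 < z.2 - (z.1 : 'rV[R]_2) 0 0.
  apply: (cvgr_gt _ (continuousB (@cvg_snd _ _ (nbhs p0) (nbhs X0) _ : {for (p0, X0),
    continuous snd}) (@xc (p0, X0)))).
  by rewrite /= subr_gt0; case/andP: q0b.
have H4 : \forall z \near (p0, X0), z.2 - (z.1 : 'rV[R]_2) 0 0 < len.
  apply: (cvgr_lt _ (continuousB (@cvg_snd _ _ (nbhs p0) (nbhs X0) _ : {for (p0, X0),
    continuous snd}) (@xc (p0, X0)))).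
  by rewrite /= ltrBlDl; case/andP: q0b.
have [[A B] /= [Ap Bs] AB] := filterI (filterI H1 H2) (filterI H3 H4).
have [e /= e0 Be] := (nbhs_ballP _ _).1 Bs.
pose eta := Num.min eps (Num.min d2 e).
have eta0 : 0 < eta by rewrite !lt_min eps0 d20.
have y1 : \forall p \near p0, -1 < (p : 'rV[R]_2) 0 1 < 1.
  have c : {for p0, continuous (fun p => p 0 1 : R)} by exact: coord_continuous.
  have [yl yu] := andP y0.
  by near=> p; apply/andP; split; near: p; [exact: (cvgr_gt _ c)|exact: (cvgr_lt _ c)].
have R0 := near_ray_root eta0.
near=> p.
have [s seta sroot] : exists2 s, `|s - X0| < eta & ray_defect p s = 0 by near: p.
have yp : -1 < p 0 1 < 1 by near: p.
have pinj : forall s s', `|s - X0| < d2 -> `|s' - X0| < d2 ->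
  ray_defect p s = ray_defect p s' -> s = s' by near: p.
have pA : A p by near: p.
move: seta; rewrite !lt_min => /and3P[seps sd2 se].
have [[F1 F2] [F3 F4]] : ((fun z : 'rV[R]_2 * R => (forall s0,
  ray_defect z.1 s0 = 0 -> 0 < ray_length z.1 s0 ->
  ray_length z.1 z.2 <= ray_length z.1 s0 \/ exists k : int,
    `|s0 + k%:~R * len - X0| < d2) /\ 0 < ray_length z.1 z.2)
   `&` (fun z : 'rV[R]_2 * R => 0 < z.2 - z.1 0 0 /\ z.2 - z.1 0 0 < len)) (p, s).
  apply: (AB (p, s)); split=> //=; apply: Be; rewrite -ball_normE /= distrC //.
move: F1 F2 F3 F4 => /= F1 F2 F3 F4.
exists (vec2 s (- dot (o p) (T s))); last by rewrite /vec2 mxE.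
have gs := ray_defect0 yp sroot.
split=> //; rewrite ?/vec2 ?mxE //=.
  by move: F3 F4; rewrite subr_gt0 ltrBlDl => -> ->.
exists (ray_length p s); split=> // r /andP[r0 rt] [s' _ gs'].
have [ds' ls'] := ray_hit yp gs'.
have ls0 : 0 < ray_length p s' by rewrite ls'.
have [|[k hk]] := F1 s' ds' ls0; first by rewrite ls' leNgt rt.
have e1 : s' + k%:~R * len = s.
  by apply: pinj => //; rewrite sroot -ds' /ray_defect curve_period.
by move: rt; rewrite -e1 /ray_length curve_period // -/(ray_length _ _) ls' ltxx.
Unshelve. all: by end_near. Qed.

End Near.

End NearStep.

(** * Differentiability *)

Section Caratheodory.
Variable R : realType.
Implicit Types (f g : 'rV[R]_2 -> R) (p : 'rV[R]_2) (a b c d : R).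

(** Differentiability at [p0] with gradient [(a, b)], expressed by an exact identity near [p0] whose
    slopes are continuous at [p0]. *)
Definition caratheodory f (p0 : 'rV[R]_2) a b := exists A B : 'rV[R]_2 -> R,
  [/\ {for p0, continuous A} /\ {for p0, continuous B}, A p0 = a, B p0 = b &
    \forall p \near p0, f p = f p0 + A p * (p 0 0 - p0 0 0) + B p * (p 0 1 - p0 0 1)].

Lemma caratheodory_eq f p0 a b a' b' : caratheodory f p0 a b -> a = a' -> b = b' ->
  caratheodory f p0 a' b'.
Proof. by move=> h <- <-. Qed.

Lemma near_caratheodory f g p0 a b : (\forall p \near p0, f p = g p) ->
  caratheodory f p0 a b -> caratheodory g p0 a b.
Proof.
move=> fg [A [B [AB Aa Bb E]]]; exists A, B; split=> //.
have fg0 := nbhs_singleton fg.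
by apply: filterS (filterI fg E) => p [<- ->]; rewrite fg0.
Qed.

Lemma caratheodory_cst c (p0 : 'rV[R]_2) : caratheodory (fun=> c) p0 0 0.
Proof.
exists (fun=> 0), (fun=> 0); split=> //; first by split; exact: cst_continuous.
by near=> p; rewrite !mul0r !addr0.
Unshelve. all: by end_near. Qed.

Lemma caratheodory_coord0 (p0 : 'rV[R]_2) : caratheodory (fun p => p 0 0) p0 1 0.
Proof.
exists (fun=> 1), (fun=> 0); split=> //; first by split; exact: cst_continuous.
by near=> p; ring.
Unshelve. all: by end_near. Qed.

Lemma caratheodory_coord1 (p0 : 'rV[R]_2) : caratheodory (fun p => p 0 1) p0 0 1.
Proof.
exists (fun=> 0), (fun=> 1); split=> //; first by split; exact: cst_continuous.
by near=> p; ring.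
Unshelve. all: by end_near. Qed.

Lemma caratheodory_continuous f p0 a b : caratheodory f p0 a b -> {for p0,
  continuous f}.
Proof.
move=> [A [B [[Ac Bc] _ _ E]]].
have c0 : {for p0, continuous (fun p => p 0 0 - p0 0 0 : R)}.
  have h : {for p0, continuous (fun p => p 0 0 : R)} by exact: coord_continuous.
  have h' : {for p0, continuous (fun=> p0 0 0 : R)} by exact: cst_continuous.
  exact: (continuousB h h').
have c1 : {for p0, continuous (fun p => p 0 1 - p0 0 1 : R)}.
  have h : {for p0, continuous (fun p => p 0 1 : R)} by exact: coord_continuous.
  have h' : {for p0, continuous (fun=> p0 0 1 : R)} by exact: cst_continuous.
  exact: (continuousB h h').
have cf : {for p0, continuous (fun=> f p0 : R)} by exact: cst_continuous.
have C := continuousD (continuousD cf (continuousM Ac c0)) (continuousM Bc c1).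
have E0 : f p0 = f p0 + A p0 * (p0 0 0 - p0 0 0) + B p0 * (p0 0 1 - p0 0 1) by ring.
have N : {near p0,
    (fun p => f p0 + A p * (p 0 0 - p0 0 0) + B p * (p 0 1 - p0 0 1)) =1 f}.
  by near=> p; symmetry; near: p.
rewrite /prop_for /continuous_at [X in _ --> X]E0.
exact: (cvg_trans (near_eq_cvg N) C).
Unshelve. all: by end_near. Qed.

Lemma caratheodory_comp f p0 a b (h : R -> R) c : caratheodory f p0 a b ->
  is_derive (f p0) 1 h c -> caratheodory (fun p => h (f p)) p0 (c * a) (c * b).
Proof.
move=> fab /is_derive1_caratheodory[k [hk kc k0]].
have fc := caratheodory_continuous fab.
have [A [B [[Ac Bc] A0 B0 E]]] := fab.
have kf : {for p0, continuous (fun p => k (f p))}.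
  exact: (@continuous_comp _ _ _ f k).
exists (fun p => k (f p) * A p), (fun p => k (f p) * B p); split.
- by split; [exact: (continuousM kf Ac)|exact: (continuousM kf Bc)].
- by rewrite k0 A0.
- by rewrite k0 B0.
- apply: filterS E => p E.
  have e : h (f p) = h (f p0) + k (f p) * (f p - f p0) by rewrite -hk addrC subrK.
  have e' : f p - f p0 = A p * (p 0 0 - p0 0 0) + B p * (p 0 1 - p0 0 1).
    by rewrite E; ring.
  by rewrite e e'; ring.
Qed.

Lemma caratheodory_add f g p0 a b c d : caratheodory f p0 a b ->
  caratheodory g p0 c d ->
  caratheodory (fun p => f p + g p) p0 (a + c) (b + d).
Proof.
move=> [A [B [[Ac Bc] A0 B0 E]]] [C [D [[Cc Dc] C0 D0 E']]].
exists (fun p => A p + C p), (fun p => B p + D p); split.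
- by split; [exact: (continuousD Ac Cc)|exact: (continuousD Bc Dc)].
- by rewrite A0 C0.
- by rewrite B0 D0.
- by apply: filterS (filterI E E') => p [-> ->]; ring.
Qed.

Lemma caratheodory_opp f p0 a b : caratheodory f p0 a b ->
  caratheodory (fun p => - f p) p0 (- a) (- b).
Proof.
move=> [A [B [[Ac Bc] A0 B0 E]]].
exists (fun p => - A p), (fun p => - B p); split.
- by split; [exact: (continuousN Ac)|exact: (continuousN Bc)].
- by rewrite A0.
- by rewrite B0.
- by apply: filterS E => p ->; ring.
Qed.

Lemma caratheodory_mul f g p0 a b c d : caratheodory f p0 a b ->
  caratheodory g p0 c d ->
  caratheodory (fun p => f p * g p) p0 (f p0 * c + g p0 * a) (f p0 * d + g p0 * b).
Proof.
move=> fab [C [D [[Cc Dc] C0 D0 E']]].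
have fc := caratheodory_continuous fab.
have [A [B [[Ac Bc] A0 B0 E]]] := fab.
have gc : {for p0, continuous (fun=> g p0 : R)} by exact: cst_continuous.
exists (fun p => f p * C p + g p0 * A p), (fun p => f p * D p + g p0 * B p); split.
- by split; [exact: (continuousD (continuousM fc Cc) (continuousM gc Ac))|
             exact: (continuousD (continuousM fc Dc) (continuousM gc Bc))].
- by rewrite A0 C0.
- by rewrite B0 D0.
- apply: filterS (filterI E E') => p [Ef Eg].
  transitivity (f p * g p0 + f p * (g p - g p0)); first by ring.
  by rewrite {1}Ef Eg; ring.
Qed.

(* Division of a function vanishing at [p0] only needs continuity of the
   divisor: this is what makes the implicit function differentiable. *)
Lemma caratheodory_div f (k : 'rV[R]_2 -> R) p0 a b : caratheodory f p0 a b ->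
  f p0 = 0 ->
  {for p0, continuous k} -> k p0 != 0 ->
  caratheodory (fun p => f p / k p) p0 (a / k p0) (b / k p0).
Proof.
move=> [A [B [[Ac Bc] A0 B0 E]]] f0 kc k0.
have kVc : {for p0, continuous (fun p => (k p)^-1)} by exact: continuousV.
exists (fun p => A p / k p), (fun p => B p / k p); split.
- by split; [exact: (continuousM Ac kVc)|exact: (continuousM Bc kVc)].
- by rewrite A0.
- by rewrite B0.
- by apply: filterS E => p ->; rewrite f0; ring.
Qed.

Lemma ler_coord_norm (v : 'rV[R]_2) j : `|v 0 j| <= `|v|.
Proof. by rewrite [leRHS]/Num.Def.normr /= mx_normrE; exact: (le_bigmax _ _ (0, j)).
  Qed.

Lemma rV2_norm_le (v : 'rV[R]_2) (M : R) : `|v 0 0| <= M -> `|v 0 1| <= M -> `|v| <= M.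
Proof.
move=> h0 h1; rewrite [leLHS]/Num.Def.normr /= mx_normrE.
apply: bigmax_le => [|[i j] _ /=]; first exact: le_trans (normr_ge0 _) h0.
by rewrite (ord1 i); case: (ord2P j) => ->.
Qed.

Lemma mulmxr2_continuous (J : 'M[R]_2) : continuous (fun v : 'rV[R]_2 => v *m J).
Proof.
have -> : (fun v : 'rV[R]_2 => v *m J) = (fun v => v 0 0 *: row 0 J + v 0 1 *: row 1 J).
  by apply/funext => v; apply: rV2P; rewrite !mxE !big_ord_recl big_ord0 addr0;
    congr (_ * _ + _ * _); congr (fun_of_matrix _ _ _); apply/val_inj.
move=> v; have c j : {for v, continuous (fun v : 'rV[R]_2 => v 0 j *: row j J)}.
  apply: (@continuous_comp _ _ _ (fun v : 'rV[R]_2 => v 0 j) ( *:%R^~ (row j J))).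
    exact: coord_continuous.
  exact: scalel_continuous.
exact: (continuousD (c 0) (c 1)).
Qed.

(** The Jacobian acts on row vectors, so each gradient is a column: hence the order [a c b d]. *)
Lemma caratheodory_jacobian (F : 'rV[R]_2 -> 'rV[R]_2) p0 a b c d :
  caratheodory (fun p => F p 0 0) p0 a b -> caratheodory (fun p => F p 0 1) p0 c d ->
  differentiable F p0 /\ jacobian F p0 = mx22 a c b d.
Proof.
move=> [A [B [[Ac Bc] A0 B0 E]]] [C [D [[Cc Dc] C0 D0 E']]].
pose J : 'M[R]_2 := mx22 a c b d.
have Jc : continuous (mulmxr J : 'rV[R]_2 -> 'rV[R]_2) := @mulmxr2_continuous J.
have key e : 0 < e -> \forall h \near (0 : 'rV[R]_2),
    `|F (h + p0) - (F p0 + h *m J)| <= e * `|h|.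
  move=> e0; have e2 : 0 < e / 2 by rewrite divr_gt0.
  have near_dist (f : 'rV[R]_2 -> R) : {for p0, continuous f} ->
      \forall p \near p0, `|f p0 - f p| <= e / 2.
    by move=> /cvgrPdist_le; apply.
  have nA := near_dist _ Ac; have nB := near_dist _ Bc.
  have nC := near_dist _ Cc; have nD := near_dist _ Dc.
  pose Q (p : 'rV[R]_2) := (((`|A p0 - A p| <= e / 2 /\ `|B p0 - B p| <= e / 2) /\
      (`|C p0 - C p| <= e / 2 /\ `|D p0 - D p| <= e / 2)) /\
     (F p 0 0 = F p0 0 0 + A p * (p 0 0 - p0 0 0) + B p * (p 0 1 - p0 0 1) /\
      F p 0 1 = F p0 0 1 + C p * (p 0 0 - p0 0 0) + D p * (p 0 1 - p0 0 1))).
  have : \forall p \near p0, Q p.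
    exact: filterI (filterI (filterI nA nB) (filterI nC nD)) (filterI E E').
  rewrite [X in X -> _](near_shift 0 p0).
  apply: filterS => h; rewrite /= subr0 /Q.
  move=> [[[hA hB] [hC hD]] [hE hE']].
  have bound (f g : 'rV[R]_2 -> R) : `|f p0 - f (h + p0)| <= e / 2 ->
      `|g p0 - g (h + p0)| <= e / 2 ->
      `|(f (h + p0) - f p0) * h 0 0 + (g (h + p0) - g p0) * h 0 1| <= e * `|h|.
    rewrite distrC => hf; rewrite distrC => hg;
      rewrite [e in _ <= e * _]splitr [leRHS]mulrDl.
    apply: le_trans (ler_normD _ _) _; rewrite !normrM.
    by apply: lerD; apply: ler_pM => //; exact: ler_coord_norm.
  have hp j : (h + p0) 0 j - p0 0 j = h 0 j by rewrite mxE addrK.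
  rewrite !hp in hE hE'.
  apply: rV2_norm_le.
    have -> : (F (h + p0) - (F p0 + h *m J)) 0 0 =
      F (h + p0) 0 0 - (F p0 0 0 + (h 0 0 * a + h 0 1 * b)).
      by rewrite mxE [X in _ + X]mxE [X in _ - X]mxE mulmx2E ![J _ _]mxE.
    rewrite hE -A0 -B0.
    have := bound A B hA hB; congr (`|_| <= _); ring.
  have -> : (F (h + p0) - (F p0 + h *m J)) 0 1 =
    F (h + p0) 0 1 - (F p0 0 1 + (h 0 0 * c + h 0 1 * d)).
    by rewrite mxE [X in _ + X]mxE [X in _ - X]mxE mulmx2E ![J _ _]mxE.
  rewrite hE' -C0 -D0.
  by have := bound C D hC hD; congr (`|_| <= _); ring.
have dFE : 'd F p0 = mulmxr J :> ('rV[R]_2 -> 'rV[R]_2).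
  apply: diff_unique => //; apply/eqaddoP => e /key; apply: filterS => h.
  by [].
split; last first.
  apply/matrixP => i j; rewrite /jacobian mxE dFE /= -rowE.
  by case: (ord2P i) => ->; case: (ord2P j) => ->; rewrite !mxE.
apply/diff_locallyP; rewrite dFE; split=> //.
apply/eqaddoP => e /key; apply: filterS => h.
by [].
Qed.

End Caratheodory.

Lemma unit_orthogonal (R : comPzRingType) (t0 t1 k0 k1 : R) :
    t0 ^+ 2 + t1 ^+ 2 = 1 -> t0 * k0 + t1 * k1 = 0 ->
  k0 = - (t0 * k1 - t1 * k0) * t1 /\ k1 = (t0 * k1 - t1 * k0) * t0.
Proof.
move=> tt tk; split.
  transitivity (k0 * (t0 ^+ 2 + t1 ^+ 2) - t0 * (t0 * k0 + t1 * k1)); last by ring.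
  by rewrite tt tk mulr1 mulr0 subr0.
transitivity (k1 * (t0 ^+ 2 + t1 ^+ 2) - t1 * (t0 * k0 + t1 * k1)); last by ring.
by rewrite tt tk mulr1 mulr0 subr0.
Qed.

Section BilliardDifferential.
Variables (R : realType) (len : R) (gamma : R -> 'rV[R]_2).
Hypothesis boundary : billiard_boundary len gamma.
Let T : R -> 'rV[R]_2 := derive1 gamma.
Let K : R -> 'rV[R]_2 := derive1n 2 gamma.
Let gammaC2 : C2_curve gamma. Proof. by have [] := boundary. Qed.
Let o : 'rV[R]_2 -> 'rV[R]_2 := outgoing gamma.

Definition curvature (s : R) : R := cross (derive1 gamma s) (derive1n 2 gamma s).

Lemma frenet (s : R) :
  K s 0 0 = - curvature s * T s 0 1 /\ K s 0 1 = curvature s * T s 0 0.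
Proof. exact: unit_orthogonal (unit_speed boundary s) (unit_speed_deriv boundary s).
  Qed.

Variables (p0 q0 : 'rV[R]_2).
Hypothesis step : billiard_step len gamma p0 q0.
Hypothesis exits : cross (o p0) (T (q0 0 0)) != 0.
Let X0 := q0 0 0.
Let x0 := p0 0 0.
Let y := p0 0 1.
Let s := Num.sqrt (1 - y ^+ 2).

Let y0 : -1 < p0 0 1 < 1. Proof. by have [] := step. Qed.
Let s0 : s != 0.
Proof.
rewrite gt_eqF // sqrtr_gt0 /y; by move: y0 => /andP[? ?]; nra.
Qed.

Let car_T j : caratheodory (fun p => T (p 0 0) 0 j) p0 (K x0 0 j) 0.
Proof.
apply: caratheodory_eq (caratheodory_comp (caratheodory_coord0 p0) (curve_deriv2
  gammaC2 x0 j)) _ _.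
  by rewrite mulr1.
by rewrite mulr0.
Qed.

Let car_gamma j : caratheodory (fun p => gamma (p 0 0) 0 j) p0 (T x0 0 j) 0.
Proof.
apply: caratheodory_eq (caratheodory_comp (caratheodory_coord0 p0) (curve_deriv
  gammaC2 x0 j)) _ _.
  by rewrite mulr1.
by rewrite mulr0.
Qed.

Let car_sqrt : caratheodory (fun p => Num.sqrt (1 - p 0 1 ^+ 2)) p0 0 (- y / s).
Proof.
have d : is_derive y 1 (fun t : R => Num.sqrt (1 - t ^+ 2)) (- y / s).
  have := deriv_sqrt _ (deriv_sub (is_derive_cst (1 : R) y 1)
     (deriv_mul (is_derive_id y 1) (is_derive_id y 1))).
  move=> /(_ _)/is_derive_eq; apply; first by move: y0; rewrite -/y /= => /andP[? ?];
    nra.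
  by rewrite /= -expr2 -/s; field.
by apply: caratheodory_eq (caratheodory_comp (caratheodory_coord1 p0) d) _ _;
  rewrite ?mulr0 ?mulr1.
Qed.

Let car_y : caratheodory (fun p => - p 0 1) p0 0 (- 1).
Proof. by apply: caratheodory_eq (caratheodory_opp (caratheodory_coord1 p0)) _ _;
  rewrite ?oppr0. Qed.

Let kap := curvature x0.

(* Both partial derivatives of the outgoing direction are multiples of its
   rotation by a right angle. *)
Let car_o0 : caratheodory (fun p => o p 0 0) p0 (kap * - o p0 0 1) (- o p0 0 1 / s).
Proof.
have -> : (fun p => o p 0 0) = (fun p =>
  - p 0 1 * T (p 0 0) 0 0 + - (Num.sqrt (1 - p 0 1 ^+ 2) * T (p 0 0) 0 1)).
  by apply/funext => p; rewrite /o outgoing0.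
have [K0 K1] := frenet x0.
have H := caratheodory_add (caratheodory_mul car_y (car_T 0))
  (caratheodory_opp (caratheodory_mul car_sqrt (car_T 1))).
apply: caratheodory_eq H _ _; rewrite /o outgoing1 -/T -/x0 -/y -/s ?K0 ?K1 -/kap.
  by ring.
by field.
Qed.

Let car_o1 : caratheodory (fun p => o p 0 1) p0 (kap * o p0 0 0) (o p0 0 0 / s).
Proof.
have -> : (fun p => o p 0 1) = (fun p =>
  - p 0 1 * T (p 0 0) 0 1 + Num.sqrt (1 - p 0 1 ^+ 2) * T (p 0 0) 0 0).
  by apply/funext => p; rewrite /o outgoing1.
have [K0 K1] := frenet x0.
have H := caratheodory_add (caratheodory_mul car_y (car_T 1))
  (caratheodory_mul car_sqrt (car_T 0)).
apply: caratheodory_eq H _ _; rewrite /o outgoing0 -/T -/x0 -/y -/s ?K0 ?K1 -/kap.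
  by ring.
by field.
Qed.

Let l := ray_length gamma p0 X0.
Let sig := cross (o p0) (T X0).
Let kap' := curvature X0.
Let ou : o p0 0 0 ^+ 2 + o p0 0 1 ^+ 2 = 1. Proof.
  exact: outgoing_unit boundary _ y0. Qed.

Let hit : gamma X0 = gamma x0 + l *: o p0.
Proof.
have [_ _ [t [t0 gt _]] _] := step.
by have [_ e] := ray_hit boundary y0 gt; rewrite /l e.
Qed.

(** The target point is kept fixed. Moving the foot of the ray along the curve contributes [s] and
    the turning of the ray contributes [- kap * l]; varying [y] only turns the ray. *)
Let car_defect : caratheodory (fun p =>
  ray_defect gamma p X0) p0 (s - kap * l) (- (l / s)).
Proof.
have -> : (fun p => ray_defect gamma p X0) = (fun p =>
  o p 0 0 * (gamma X0 0 1 + - gamma (p 0 0) 0 1)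
   + - (o p 0 1 * (gamma X0 0 0 + - gamma (p 0 0) 0 0))).
  by apply/funext => p; rewrite /ray_defect /cross !mxE.
have c j := caratheodory_add (caratheodory_cst (gamma X0 0 j) p0) (caratheodory_opp
  (car_gamma j)).
have h j : gamma X0 0 j + - gamma (p0 0 0) 0 j = l * o p0 0 j.
  by rewrite hit mxE addrAC subrr add0r mxE.
have st := cross_outgoing_start boundary p0; rewrite -/o -/T -/y -/s /cross in st.
apply: caratheodory_eq (caratheodory_add (caratheodory_mul car_o0 (c 1))
  (caratheodory_opp (caratheodory_mul car_o1 (c 0)))) _ _; rewrite !h.
  transitivity (- (o p0 0 0 * T x0 0 1 - o p0 0 1 * T x0 0 0) - kap * l * (o p0 0 0
    ^+ 2 + o p0 0 1 ^+ 2)).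
    by ring.
  by rewrite st ou; ring.
transitivity (- (l / s) * (o p0 0 0 ^+ 2 + o p0 0 1 ^+ 2)); first by ring.
by rewrite ou mulr1.
Qed.

Let X p := billiard_map len gamma p 0 0.

Let X_p0 : X p0 = X0. Proof. by rewrite /X (billiard_mapE boundary step). Qed.

Let X_continuous : {for p0, continuous X}.
Proof.
suff : forall e, 0 < e -> \forall p \near p0, `|X0 - X p| < e.
  by rewrite /prop_for /continuous_at X_p0 => h;
    apply/(@cvgrPdist_lt _ _ _ _ (nbhs_filter p0)).
move=> e e0; have := near_billiard_step boundary step exits e0.
by apply: filterS => p [q pq]; rewrite /X (billiard_mapE boundary pq) distrC.
Qed.

Let near_step : \forall p \near p0,
  billiard_step len gamma p (billiard_map len gamma p).
Proof.
have := near_billiard_step boundary step exits ltr01; apply: filterS => p [q pq _].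
by rewrite (billiard_mapE boundary pq).
Qed.

Let car_X : caratheodory X p0 ((kap * l - s) / sig) (l / (s * sig)).
Proof.
have [h [hE hc hT]] := curve_secant boundary X0.
(* The secant slope of the defect between [X0] and [X p]. It gives the implicit function explicitly,
   [X p = X0 - ray_defect p X0 / k p], with [k] continuous at [p0] because [X] is. *)
pose k p := o p 0 0 * h 1 (X p) - o p 0 1 * h 0 (X p).
have kc : {for p0, continuous k}.
  have c j : {for p0, continuous (fun p => h j (X p))}.
    apply: (@continuous_comp _ _ _ X (h j)); first exact: X_continuous.
    by rewrite X_p0; exact: hc.
  exact: (continuousB (continuousM (@outgoing_continuous _ _ _ boundary 0 p0) (c 1))
    (continuousM (@outgoing_continuous _ _ _ boundary 1 p0) (c 0))).
have k0 : k p0 = sig by rewrite /k X_p0 !hT.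
have kn0 : k p0 != 0 by rewrite k0.
have d0 : ray_defect gamma p0 X0 = 0.
  by have [_ _ [t [_ gt _]] _] := step; have [] := ray_hit boundary y0 gt.
have := caratheodory_add (caratheodory_cst X0 p0)
  (caratheodory_opp (caratheodory_div car_defect d0 kc kn0)).
rewrite k0 => H; apply: near_caratheodory; last first.
  by apply: caratheodory_eq H _ _; field; rewrite ?s0 ?exits.
have nk : \forall p \near p0, k p != 0 by exact: (cvgr_neq0 _ kc).
apply: filterS (filterI near_step nk) => p [st kp].
have [py _ [t [t0 gt _]] _] := st.
have [dX _] := ray_hit boundary py gt.
have e : ray_defect gamma p (X p) = ray_defect gamma p X0 + (X p - X0) * k p.
  rewrite /ray_defect /cross /k.
  have -> : (X p - X0) * (o p 0 0 * h 1 (X p) - o p 0 1 * h 0 (X p)) =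
    o p 0 0 * (h 1 (X p) * (X p - X0)) - o p 0 1 * (h 0 (X p) * (X p - X0)) by ring.
  have m u j : (gamma u - gamma (p 0 0)) 0 j = gamma u 0 j - gamma (p 0 0) 0 j
    by rewrite !mxE.
  by rewrite -!hE -/o !m; ring.
rewrite -/(X p) e in dX; apply: (mulIf kp); rewrite mulrBl divfK //.
by apply/eqP; rewrite subr_eq; apply/eqP; rewrite -[LHS]addr0 -dX; ring.
Qed.

Let car_Y : caratheodory (fun p => billiard_map len gamma p 0 1) p0
    (- sig * kap + kap' * sig * ((kap * l - s) / sig))
  (- sig / s + kap' * sig * (l / (s * sig))).
Proof.
have cT j : caratheodory (fun p =>
  T (X p) 0 j) p0 (K X0 0 j * ((kap * l - s) / sig)) (K X0 0 j * (l / (s * sig))).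
  by apply: (caratheodory_comp (h := fun t => T t 0 j) car_X); rewrite X_p0;
    exact: curve_deriv2.
have [K0 K1] := frenet X0.
apply: near_caratheodory; last first.
  apply: caratheodory_eq (caratheodory_opp (caratheodory_add (caratheodory_mul car_o0
    (cT 0))
     (caratheodory_mul car_o1 (cT 1)))) _ _; rewrite X_p0 K0 K1 -/kap'.
    set u := _ / sig; rewrite /sig /cross; ring.
  set u := l / (s * sig); rewrite /sig /cross; field.
  by [].
apply: filterS near_step => p [_ _ _ ->].
by rewrite /dot.
Qed.

Lemma billiard_map_jacobian :
  differentiable (billiard_map len gamma) p0 /\
  jacobian (billiard_map len gamma) p0 =
    mx22 ((kap * l - s) / sig) (- sig * kap + kap' * sig * ((kap * l - s) / sig))
         (l / (s * sig)) (- sig / s + kap' * sig * (l / (s * sig))).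
Proof. exact: (caratheodory_jacobian car_X car_Y). Qed.

End BilliardDifferential.

(** * The monodromy of a periodic trajectory *)

(** With [w] a chord, this resolves the product of the two end tangents into parts along and across
    the chord. *)
Lemma lagrange_identity (R : comPzRingType) (w a b : 'rV[R]_2) :
  (a 0 0 * b 0 0 + a 0 1 * b 0 1) * (w 0 0 * w 0 0 + w 0 1 * w 0 1) =
  (w 0 0 * a 0 0 + w 0 1 * a 0 1) * (w 0 0 * b 0 0 + w 0 1 * b 0 1) +
  (w 0 1 * a 0 0 - w 0 0 * a 0 1) * (w 0 1 * b 0 0 - w 0 0 * b 0 1).
Proof. ring. Qed.

(** Where geometry meets the generating function: the left side is the differential of the first-hit
    map, and the entries on the right will be recognized as S11, S12, S22. *)
Lemma segment_transferE (F : fieldType) (k k' l s s' : F) :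
    l != 0 -> s != 0 -> s' != 0 ->
  mx22 ((k * l - s) / s') (- s' * k + k' * s' * ((k * l - s) / s'))
       (l / (s * s')) (- s' / s + k' * s' * (l / (s * s'))) =
  transfer (fun=> k * s - s ^+ 2 / l) (fun=> - (s * s' / l))
           (fun=> k' * s' - s' ^+ 2 / l) 0.
Proof.
by move=> l0 s0 s'0; apply: mx22P; rewrite !mxE /=; field;
  rewrite ?oppr_eq0 ?mulf_eq0 ?negb_or ?l0 ?s0 ?s'0.
Qed.

Section Monodromy.
Variables (R : realType) (len : R) (gamma : R -> 'rV[R]_2).
Hypothesis boundary : billiard_boundary len gamma.
Let T : R -> 'rV[R]_2 := derive1 gamma.
Let K : R -> 'rV[R]_2 := derive1n 2 gamma.
Let gammaC2 : C2_curve gamma. Proof. by have [] := boundary. Qed.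

Lemma curvature_period (s : R) (k : int) : curvature gamma (s + k%:~R * len) =
  curvature gamma s.
Proof.
by rewrite /curvature (curve_deriv_period boundary s k) (curve_deriv2_period boundary
  s k).
Qed.

Lemma chordC (s t : R) : chord gamma s t = chord gamma t s.
Proof. by rewrite /chord -opprB /enorm dotNl dotC dotNl opprK. Qed.

Section Segment.
Variables (u v : R).
Hypothesis uv : admissible_segment len gamma u v.
Let l := chord gamma u v.
Let s := sin_start gamma u v.
Let s' := sin_end gamma u v.
Let g1 := gen1 gamma u v.
Let g2 := gen2 gamma u v.

Let l0 : l != 0.
Proof. by rewrite gt_eqF // chord_gt0 // (admissible_neq boundary uv). Qed.

Let dT_start : dot (gamma u - gamma v) (T u) = - g1 * l.
Proof. by rewrite /g1 /gen1 -/T -/l; field. Qed.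

Let dT_end : dot (gamma u - gamma v) (T v) = g2 * l.
Proof. by rewrite /g2 /gen2 -/T -/l; field. Qed.

Let dn_start :
  (gamma u - gamma v) 0 1 * T u 0 0 - (gamma u - gamma v) 0 0 * T u 0 1 = - s * l.
Proof.
rewrite /s /sin_start -/T -/l dot_normal -/T mulNr divfK // !mxE; ring.
Qed.

Let dn_end :
  (gamma u - gamma v) 0 1 * T v 0 0 - (gamma u - gamma v) 0 0 * T v 0 1 = s' * l.
Proof. by rewrite /s' /sin_end -/T -/l dot_normal -/T divfK // !mxE; ring. Qed.

Let dK (t : R) : dot (gamma u - gamma v) (K t) = curvature gamma t *
  ((gamma u - gamma v) 0 1 * T t 0 0 - (gamma u - gamma v) 0 0 * T t 0 1).
Proof. by rewrite /dot; have [-> ->] := frenet boundary t; rewrite -/T; ring. Qed.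

Let dTT (t : R) : dot (T t) (T t) = 1.
Proof. by rewrite /dot -!expr2 (unit_speed boundary). Qed.

Lemma gen11E : gen11 gamma u v = curvature gamma u * s - s ^+ 2 / l.
Proof.
rewrite /gen11 -/T -/K -/l dTT dT_start dK dn_start (sin_start_sqr boundary uv) -/g1.
by field.
Qed.

Lemma gen22E : gen22 gamma u v = curvature gamma v * s' - s' ^+ 2 / l.
Proof.
rewrite /gen22 -/T -/K -/l dTT dT_end dK dn_end (sin_end_sqr boundary uv) -/g2.
by field.
Qed.

Lemma gen12E : gen12 gamma u v = - (s * s' / l).
Proof.
have l2 : dot (gamma u - gamma v) (gamma u - gamma v) = l ^+ 2 by rewrite /l chord_sqr.
rewrite /gen12 -/T -/l dT_start dT_end.
have e : dot (T u) (T v) * l ^+ 2 = (- g1 * l) * (g2 * l) + (- s * l) * (s' * l).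
  by rewrite -dT_start -dT_end -dn_start -dn_end -l2; exact: lagrange_identity.
have -> : dot (T u) (T v) = - g1 * g2 - s * s'.
  apply: (mulIf (_ : l ^+ 2 != 0)); first by rewrite sqrf_eq0.
  by rewrite e; ring.
by field.
Qed.

(** The twist condition, equivalent here to transversality at both ends. *)
Lemma gen12_neq0 : gen12 gamma u v != 0.
Proof.
rewrite gen12E oppr_eq0 mulf_neq0 ?invr_eq0 // mulf_neq0 // gt_eqF //.
  exact: (sin_start_gt0 boundary uv).
exact: (sin_end_gt0 boundary uv).
Qed.

(** An arbitrary lift of the starting point is allowed because the orbit of the lifted map may drift
    by periods from the lifts recorded in a path. *)
Lemma segment_jacobian (k : int) (p := vec2 (u + k%:~R * len) (- gen1 gamma u v)) :
    [/\ exists k' : int,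
        billiard_map len gamma p = vec2 (v + k'%:~R * len) (gen2 gamma u v),
      differentiable (billiard_map len gamma) p &
      jacobian (billiard_map len gamma) p =
                transfer (fun=> gen11 gamma u v) (fun=> gen12 gamma u v)
          (fun=> gen22 gamma u v) 0].
Proof.
set u' := u + k%:~R * len in p *.
have gu : gamma u' = gamma u by rewrite /u' (curve_period boundary).
have Tu : T u' = T u by exact: (curve_deriv_period boundary).
have Ku : curvature gamma u' = curvature gamma u.
  exact: curvature_period.
have [k' /andP[w1 w2]] := period_reduce boundary u' v.
set w := v + k'%:~R * len in w1 w2.
have gw : gamma w = gamma v by rewrite /w (curve_period boundary).
have Tw : T w = T v by exact: (curve_deriv_period boundary).
have Kw : curvature gamma w = curvature gamma v.
  exact: curvature_period.
have uw : u' < w < u' + len.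
  rewrite w2 andbT lt_neqAle w1 andbT; apply/eqP => e.
  have := admissible_neq boundary uv; rewrite -[gamma u]gu -[gamma v]gw.
  by rewrite e => /eqP; apply.
have st := admissible_billiard_step boundary uv gu Tu uw gw Tw.
have oE := outgoing_chord boundary uv gu Tu.
have e0 : (vec2 w (gen2 gamma u v)) 0 0 = w by rewrite /vec2 mxE.
have p00 : p 0 0 = u' by rewrite /p /vec2 mxE.
have p01 : p 0 1 = - gen1 gamma u v by rewrite /p /vec2 mxE.
have sig : cross (outgoing gamma p) (T w) = s'.
  rewrite oE Tw; apply: (mulIf l0); rewrite -dn_end /cross !mxE -/l.
  by field.
have s'0 : s' != 0 := lt0r_neq0 (sin_end_gt0 boundary uv).
have s0 : s != 0 := lt0r_neq0 (sin_start_gt0 boundary uv).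
have ex : cross (outgoing gamma p) (T ((vec2 w (gen2 gamma u v)) 0 0)) != 0.
  rewrite e0 sig; exact: s'0.
have [df jE] := billiard_map_jacobian boundary st ex.
split; [by exists k'; exact: (billiard_mapE boundary st)|exact: df|].
rewrite jE e0 p00 p01 -/T sig Ku Kw.
have -> : Num.sqrt (1 - (- gen1 gamma u v) ^+ 2) = s.
  rewrite sqrrN -(sin_start_sqr boundary uv) sqrtr_sqr (gtr0_norm (sin_start_gt0
    boundary uv)).
  reflexivity.
have -> : ray_length gamma p w = l.
  rewrite /ray_length p00 gu gw oE dotC dotZl -chord_sqr (chordC v u) -/l.
  by field.
rewrite gen11E gen12E gen22E; exact: (segment_transferE _ _ l0 s0 s'0).
Qed.

End Segment.

Lemma jacobian_comp (f g : 'rV[R]_2 -> 'rV[R]_2) p :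
  differentiable g p -> differentiable f (g p) ->
  jacobian (f \o g) p = jacobian g p *m jacobian f (g p).
Proof.
move=> dg df; apply/row_matrixP => i.
pose e : 'rV[R]_2 := delta_mx 0 i.
have E (h : 'rV[R]_2 -> 'rV[R]_2) (q v : 'rV[R]_2) : v *m jacobian h q = 'd h q v.
  exact: mul_rV_lin1.
have -> : row i (jacobian (f \o g) p) = 'd (f \o g) p e.
  exact: etrans (rowE i _) (E (f \o g) p e).
have -> : row i (jacobian g p *m jacobian f (g p)) = 'd f (g p) ('d g p e).
  have g_row : row i (jacobian g p) = 'd g p e by exact: etrans (rowE i _) (E g p e).
  by rewrite row_mul g_row; exact: E.
exact: (congr1 (fun h : 'rV[R]_2 -> 'rV[R]_2 => h e) (diff_comp dg df)).
Qed.

Section Trajectory.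
Variables (N : nat) (x : 'rV[R]_N.+1).
Hypothesis N2 : (2 <= N)%N.
Hypothesis traj : periodic_trajectory len gamma x.

(** The end index is [(k %% N).+1], so the closing segment ends at vertex [N], which may be a
    different lift of vertex 0. *)
Definition segment_a k := gen11 gamma (vertex x (k %% N)) (vertex x (k %% N).+1).
Definition segment_b k := gen12 gamma (vertex x (k %% N)) (vertex x (k %% N).+1).
Definition segment_d k := gen22 gamma (vertex x (k %% N)) (vertex x (k %% N).+1).

Let adm i : (i < N)%N -> admissible_segment len gamma (vertex x i) (vertex x i.+1).
Proof. by have [+ _ _ _] := traj; apply. Qed.

Lemma segment_b_neq0 k : segment_b k != 0.
Proof. by apply: gen12_neq0; apply: adm; rewrite ltn_mod; lia. Qed.

Let orbit m := iter m (billiard_map len gamma) (initial_phase gamma x).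

(** Criticality at an inner vertex equates the arriving momentum [gen2] with the departing one,
    [- gen1]: it is the reflection law. *)
Lemma orbit_phase i : (i < N)%N -> exists k : int,
  orbit i = vec2 (vertex x i + k%:~R * len) (- gen1 gamma (vertex x i) (vertex x i.+1)).
Proof.
elim: i => [|i IHi] iN.
  exists 0; rewrite mul0r addr0 /orbit /= /initial_phase d1genE //.
  exact: (admissible_neq boundary (adm iN)).
have [k Pk] := IHi (ltnW iN).
have [[k' e] _ _] := segment_jacobian (adm (ltnW iN)) k.
exists k'; rewrite /orbit iterS -/(orbit i) Pk e; congr vec2.
have [_ _ crit _] := traj; have := crit i.+1 iN.
rewrite d1genE ?d2genE //=; last 2 first.
- exact: (admissible_neq boundary (adm (ltnW iN))).
- exact: (admissible_neq boundary (adm iN)).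
by move/eqP; rewrite addrC addr_eq0 => /eqP.
Qed.

Lemma orbit_jacobian m : (m <= N)%N ->
  differentiable (iter m (billiard_map len gamma)) (initial_phase gamma x) /\
  jacobian (iter m (billiard_map len gamma)) (initial_phase gamma x) =
    transfer_prod segment_a segment_b segment_d m.
Proof.
elim: m => [|m IHm] mN.
  have [did dE] := is_diff_id (initial_phase gamma x : 'rV[R]_2).
  split; first exact: did.
  apply/row_matrixP => i; apply: etrans (rowE i _) _; apply: etrans (mul_rV_lin1 _ _) _.
  apply: etrans (congr1 (fun h : 'rV[R]_2 -> 'rV[R]_2 => h (delta_mx 0 i)) dE) _.
  by rewrite row1.
have [dm jm] := IHm (ltnW mN).
have [k Pk] := orbit_phase mN.
have [_ dP jP] := segment_jacobian (adm mN) k.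
rewrite -Pk /orbit in dP jP.
have -> : iter m.+1 (billiard_map len gamma) = billiard_map len gamma \o iter m
  (billiard_map len gamma) by [].
split; first exact: differentiable_comp.
rewrite jacobian_comp // jm jP /=; congr (_ *m _).
by rewrite /transfer /segment_a /segment_b /segment_d modn_small.
Qed.

End Trajectory.

End Monodromy.

(** * The periodic index and its parity *)

Section PeriodicVariations.
Variables (R : realType) (m : nat).
Hypothesis m0 : (0 < m)%N.

Definition periodic_basis : 'M[R]_(m, m.+1) := \matrix_(i, k) cyclic_unit R i k.

Lemma periodic_basis_free : row_free periodic_basis.
Proof.
apply/row_freeP; exists (\matrix_(k, i) (k == widen_ord (leqnSn m) i)%:R).
apply/matrixP => i j; rewrite !mxE.
under eq_bigr do rewrite !mxE mulrC.
rewrite sum_indicator /cyclic_unit /= modn_small // eq_sym //.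
Qed.

Lemma periodic_basisP (v : 'rV[R]_m.+1) :
  (v <= periodic_basis)%MS <-> periodic_variation v.
Proof.
split=> [/submxP[c ->]|v0].
  rewrite /periodic_variation !mxE; apply: eq_bigr => i _; congr (_ * _).
  by rewrite !mxE /cyclic_unit mod0n modnn.
apply/submxP; exists (\row_i v 0 (widen_ord (leqnSn m) i)).
apply/rowP => k; rewrite !mxE.
under eq_bigr do rewrite !mxE mulrC.
have E (l : 'I_m) : (k %% m)%N = l -> v 0 k = v 0 (widen_ord (leqnSn m) l).
  move=> kl; have [km|] := ltnP k m.
    by congr (v _ _); apply/val_inj; rewrite /= -kl modn_small.
  move=> mk; have kE : k = ord_max by apply/val_inj/eqP;
    rewrite /= eqn_leq mk -ltnS ltn_ord.
  rewrite kE -v0; congr (v _ _); apply/val_inj; rewrite /= -kl kE /= modnn //.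
rewrite (bigD1 (Ordinal (ltn_pmod k m0))) //= big1 => [|l].
  by rewrite /cyclic_unit eqxx mul1r addr0 -E.
move=> lk; rewrite /cyclic_unit; case: eqP => [e|]; last by rewrite mul0r.
by case/eqP: lk; apply/val_inj; rewrite /= e.
Qed.

End PeriodicVariations.

Section IndexSide.
Variables (R : realType) (gamma : R -> 'rV[R]_2).
Hypothesis gammaC2 : C2_curve gamma.
Variables (m : nat) (z : 'rV[R]_m.+1).
Hypotheses (m0 : (0 < m)%N) (zi : immersed gamma z).

Let H := hessian gamma z.
Let E := periodic_basis R m.

Lemma hessian_entry i j : H i j = jacobi_form (hess_a gamma z) (hess_b gamma z)
  (hess_d gamma z) m
  (vertex (delta_mx 0 i : 'rV[R]_m.+1)) (vertex (delta_mx 0 j : 'rV[R]_m.+1)).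
Proof. by rewrite -hess_formE // -[RHS]/(bform H _ _) bform_delta. Qed.

Lemma hessian_sym : H^T = H.
Proof.
apply/matrixP => i j; rewrite mxE !hessian_entry; apply: eq_bigr => k _.
by ring.
Qed.

Lemma periodic_hessianE a b d :
  (forall k, (k < m)%N -> [/\ hess_a gamma z k = a k,
    hess_b gamma z k = b k & hess_d gamma z k = d k]) ->
  E *m H *m E^T = cyclic_jacobi a b d m.
Proof.
move=> abd; apply/matrixP => i j.
have -> : (E *m H *m E^T) i j = bform H (row i E) (row j E).
  by rewrite -bform_delta /bform !rowE trmx_mul !mulmxA.
rewrite -[LHS]/(hess_form gamma z _ _) hess_formE // mxE.
have vE (l : 'I_m) k : (k <= m)%N -> vertex (row l E) k = cyclic_unit R l k.
  by move=> km; rewrite /vertex !mxE inordK.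
by apply: jacobi_form_eq => k km; [exact: abd|rewrite !vE].
Qed.

(** In the basis [E] of periodic variations, nondegeneracy is invertibility of the Gram matrix. *)
Lemma odd_periodic_index : periodic_nondegenerate gamma z ->
  \det (E *m H *m E^T) != 0 /\
  odd (periodic_index gamma z) = (\det (E *m H *m E^T) < 0).
Proof.
move=> nd.
have Ef : row_free E by exact: periodic_basis_free.
have D0 : \det (E *m H *m E^T) != 0.
  apply/negP => /det0P[c c0 cA].
  case/negP: c0; apply/eqP; apply: (row_free_inj Ef); rewrite mul0mx.
  apply: nd; first by apply/periodic_basisP => //; exact: submxMl.
  move=> w /(periodic_basisP m0)/submxP[c' ->].
  by rewrite /hess_form trmx_mul !mulmxA -/H -(mulmxA c) -(mulmxA c) cA mul0mx mxE.
split=> //.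
have [k [km [U [dU UE Un]] Umax <-]] := index_parity hessian_sym Ef D0.
congr odd; apply/eqP; rewrite eqn_leq; apply/andP; split.
  apply/bigmax_leqP => l /asboolP[U' [<- U'p U'n]]; apply: Umax => // v vU.
  by apply/(periodic_basisP m0); exact: U'p.
have kM : (k < m.+2)%N by lia.
apply: (@leq_bigmax_cond _ _ (fun i : 'I_m.+2 => nat_of_ord i) (Ordinal kM)).
apply/asboolP; exists U; split=> // v vU.
by apply/(periodic_basisP m0); exact: UE.
Qed.

End IndexSide.

Section SecondIterate.
Variables (R : realType) (len : R) (gamma : R -> 'rV[R]_2).
Hypothesis boundary : billiard_boundary len gamma.
Variables (N : nat) (x : 'rV[R]_N.+1).
Hypothesis N2 : (2 <= N)%N.
Hypothesis traj : periodic_trajectory len gamma x.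

Lemma vertex_second_iterate k : (k <= 2 * N)%N ->
  vertex (second_iterate x) k = vertex x (if (k <= N)%N then k else (k - N)%N).
Proof. by move=> kN; rewrite /vertex mxE inordK // ltnS. Qed.

Let closing : exists k : int, vertex x N = vertex x 0 + k%:~R * len.
Proof.
by have [_ /(curve_eq boundary)/esym/(curve_eq boundary)[k ->] _ _] := traj; exists k.
Qed.

Let segment_second_iterate (h : R -> R -> R) k : (k < 2 * N)%N ->
    (forall u v (j : int), h (u + j%:~R * len) v = h u v) ->
  h (vertex (second_iterate x) k) (vertex (second_iterate x) k.+1) =
  h (vertex x (k %% N)) (vertex x (k %% N).+1).
Proof.
move=> kN hp; rewrite !vertex_second_iterate //; last exact: ltnW.
have [kltN|] := ltnP k N; first by rewrite (ltnW kltN) modn_small.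
(* The seam [k = N]: the second round starts from vertex [N] of [x] instead of vertex 0, which is
   where periodicity of [h] enters. *)
rewrite leq_eqVlt => /orP[/eqP <-|Nk].
  have [j e] := closing.
  by rewrite leqnn subSnn modnn e hp.
rewrite leqNgt Nk /= subSn; last exact: ltnW.
by rewrite -{3 4}(subnK (ltnW Nk)) modnDr modn_small //; lia.
Qed.

Lemma second_iterate_immersed : immersed gamma (second_iterate x).
Proof.
move=> k kN.
have hp u v (j : int) : (gamma (u + j%:~R * len) != gamma v) = (gamma u != gamma v).
  by rewrite (curve_period boundary).
have kmod : (k %% N < N)%N by rewrite ltn_mod; lia.
have [adm _ _ _] := traj; have := admissible_neq boundary (adm _ kmod).
(* The inequality is encoded as a real number to fit the transport of segment data. *)
pose h u v : R := (gamma u != gamma v)%:R.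
have e := @segment_second_iterate h k kN.
have {}e := e (fun u v j => congr1 (fun b : bool => b%:R) (hp u v j)).
move: e; rewrite /h => e nz; move: e; rewrite nz.
by case: (_ != _) => // /eqP; rewrite eq_sym oner_eq0.
Qed.

Lemma second_iterate_index : periodic_nondegenerate gamma (second_iterate x) ->
  let t := \tr (jacobian (iter N (billiard_map len gamma)) (initial_phase gamma x)) in
  t ^+ 2 != 4 /\ odd (periodic_index gamma (second_iterate x)) = (t ^+ 2 < 4).
Proof.
move=> nd t.
have [_ jE] := orbit_jacobian boundary traj (leqnn N).
have gammaC2 : C2_curve gamma by have [] := boundary.
have m0 : (0 < 2 * N)%N by lia.
have Tp := curve_deriv_period boundary; have Kp := curve_deriv2_period boundary.
have gp := curve_period boundary.
have [D0 oddE] := odd_periodic_index gammaC2 m0 second_iterate_immersed nd.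
have HE := @periodic_hessianE _ gamma gammaC2 _ _ second_iterate_immersed
   (segment_a gamma x) (segment_b gamma x) (segment_d gamma x).
have {}HE := HE _.
rewrite HE in D0 oddE; last first.
  move=> k kN; split; apply: segment_second_iterate => // u v j.
  - by rewrite /gen11 /chord !gp !Tp !Kp.
  - by rewrite /gen12 /chord !gp !Tp.
  - by rewrite /gen22 /chord !gp.
have bN0 := segment_b_neq0 boundary N2 traj.
have dE : \det (cyclic_jacobi (segment_a gamma x) (segment_b gamma x) (segment_d
  gamma x) (2 * N)) =
   (\prod_(k < N) segment_b gamma x k) ^+ 2 * (t ^+ 2 - 4).
  rewrite /t jE; apply: det_cyclic_jacobi_double => //; first lia.
  - by move=> k; rewrite /segment_a modnDr.
  - by move=> k; rewrite /segment_b modnDr.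
  - by move=> k; rewrite /segment_d modnDr.
have P0 : 0 < (\prod_(k < N) segment_b gamma x k) ^+ 2.
  by rewrite exprn_even_gt0 //=; apply/prodf_neq0.
rewrite dE in D0 oddE; split.
  by apply: contra_neq D0 => ->; rewrite subrr mulr0.
by rewrite oddE pmulr_rlt0 // subr_lt0.
Qed.

Lemma det_monodromy : \det (jacobian (iter N (billiard_map len gamma)) (initial_phase
  gamma x)) = 1.
Proof.
have [_ ->] := orbit_jacobian boundary traj (leqnn N).
by apply: det_transfer_prod; exact: (segment_b_neq0 boundary N2 traj).
Qed.

End SecondIterate.

Lemma multiplier_root (R : realType) (len : R) gamma N (x : 'rV[R]_N.+1) s mu :
  multipliers_are len gamma x s -> multiplier len gamma x mu = (mu \in s).
Proof.
by move=> ms; rewrite /multiplier eigenvalue_root_char ms root_prod_XsubC.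
Qed.

Theorem proposition2p23 (R : realType) (len : R) (gamma : R -> 'rV[R]_2)
    (N : nat) (x : 'rV[R]_N.+1) :
  billiard_boundary len gamma ->
  (2 <= N)%N ->
  periodic_trajectory len gamma x ->
  periodic_nondegenerate gamma (second_iterate x) ->
  (odd (periodic_index gamma (second_iterate x)) ->
     (exists mu : R[i],
        [/\ mu \isn't Num.real, `|mu| = 1 &
            multipliers_are len gamma x [:: mu; Num.conj mu]]) /\
     linearly_stable len gamma x) /\
  (~~ odd (periodic_index gamma (second_iterate x)) ->
     (exists mu : R,
        mu != 0 /\
        multipliers_are len gamma x
          [:: real_complex R mu; real_complex R mu^-1]) /\
     linearly_unstable len gamma x).
Proof.
move=> boundary N2 traj nd.
have [t4 oddE] := second_iterate_index boundary N2 traj nd.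
have dM := det_monodromy boundary N2 traj.
rewrite oddE; split=> [tlt|tge].
  have [mu [mur mu1 ms]] := elliptic_multipliers dM tlt.
  split; first by exists mu.
  move=> nu; rewrite (multiplier_root _ ms) !inE => /orP[] /eqP ->.
    by rewrite mu1.
  by rewrite norm_conjC mu1.
have tgt : 4 < (\tr (jacobian (iter N (billiard_map len gamma)) (initial_phase gamma x))) ^+ 2.
  by rewrite lt_neqAle eq_sym t4 leNgt.
have [mu [mu0 ms mu1]] := hyperbolic_multipliers dM tgt.
split; first by exists mu.
(* Stability would bound both [mu] and its inverse by 1 in modulus, forcing modulus 1. *)
move=> stable.
have normC (r : R) : `|real_complex R r| = real_complex R `|r|.
  by rewrite normc_def /= expr0n addr0 sqrtr_sqr.
have h1 : `|mu| <= 1.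
  have := stable (real_complex R mu); rewrite (multiplier_root _ ms) !inE eqxx normC lecR.
  by apply.
have h2 : `|mu^-1| <= 1.
  have := stable (real_complex R mu^-1); rewrite (multiplier_root _ ms) !inE eqxx orbT normC lecR.
  by apply.
case/negP: mu1; rewrite eq_le h1 /=.
by rewrite -invf_le1 ?normr_gt0 // -normfV.
Qed.
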